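(* Let $\mathcal{GC}=\mathcal{GC}(\widetilde B,\mathcal P)$ be a generalized cluster structure of geometric type with $N$ cluster variables, and let $\widehat{\mathbb A}$ be a ground ring with $\mathbb A\subseteq\widehat{\mathbb A}\subseteq\bar{\mathbb A}$. If the generalized exchange polynomials are coprime in $\mathbb A[x_1,\dots,x_N]$ for any seed in $\mathcal{GC}$ (where $x_1,\dots,x_N$ denote the cluster variables of that seed), then the upper bounds $\overline{\mathcal A}(\mathcal N)$ do not depend on the choice of the nerve $\mathcal N$, and hence coincide with the upper cluster algebra $\overline{\mathcal A}(\widetilde B,\mathcal P)$ over $\widehat{\mathbb A}$.
   Context: **Generalized cluster structures.** Let $\widetilde B=(b_{ij})$ be an $N\times(N+M)$ integer matrix whose principal part (leading $N\times N$ submatrix) is skew-symmetrizable. Let $\mathcal F$ be the field of rational functions in $N+M$ independent variables with rational coefficients; $M$ distinguished variables $x_{N+1},\dots,x_{N+M}$ are called stable. Put $\mathbb A=\mathbb Z[x_{N+1},\dots,x_{N+M}]$ and $\bar{\mathbb A}=\mathbb Z[x_{N+1}^{\pm1},\dots,x_{N+M}^{\pm1}]$. For each $1\le i\le N$ fix a positive factor $d_i$ of $\gcd\{b_{ij}:1\le j\le N\}$. A seed is a triple $\Sigma=(\mathbf x,\widetilde B,\mathcal P)$, where $\mathbf x=(x_1,\dots,x_N)$ (the cluster) is a transcendence basis of $\mathcal F$ over the field of fractions of $\bar{\mathbb A}$, and $\mathcal P$ is a set of $N$ strings; the $i$th string is a collection of monomials $p_{ir}\in\mathbb A$, $0\le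 r\le d_i$, with $p_{i0}=p_{id_i}=1$. The adjacent seed in direction $k$, $1\le k\le N$, is $(\mathbf x',\widetilde B',\mathcal P')$ with $\mathbf x'=(\mathbf x\setminus\{x_k\})\cup\{x_k'\}$, where $$x_kx_k'=\sum_{r=0}^{d_k}p_{kr}u_{k;>}^r v_{k;>}^{[r]}u_{k;<}^{d_k-r}v_{k;<}^{[d_k-r]},$$ $u_{k;>}=\prod\{x_i^{b_{ki}/d_k}:1\le i\le N,b_{ki}>0\}$, $u_{k;<}=\prod\{x_i^{-b_{ki}/d_k}:1\le i\le N,b_{ki}<0\}$, $v_{k;>}^{[r]}=\prod\{x_i^{\lfloor rb_{ki}/d_k\rfloor}:N+1\le i\le N+M,b_{ki}>0\}$, $v_{k;<}^{[r]}=\prod\{x_i^{\lfloor -rb_{ki}/d_k\rfloor}:N+1\le i\le N+M,b_{ki}<0\}$; the right-hand side is called the generalized exchange polynomial (in direction $k$ at this seed). Further, $b'_{ij}=-b_{ij}$ if $i=k$ or $j=k$ and $b'_{ij}=b_{ij}+\frac12(|b_{ik}|b_{kj}+b_{ik}|b_{kj}|)$ otherwise; $p'_{kr}=p_{k,d_k-r}$ and $p'_{ir}=p_{ir}$ for $i\ne k$. The generalized cluster structure $\mathcal{GC}(\widetilde B,\mathcal P)$ is the set of all seeds obtained from $\Sigma$ by sequences of such mutations. The seeds are attached to the vertices of the $N$-regular tree $\mathbb T_N$ whose edges are labelled by the directions $1,\dots,N$ (the $N$ edges at each vertex have different labels), adjacent vertices carrying seeds adjacent in the direction of the edge label. The generalized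 upper cluster algebra $\overline{\mathcal A}(\widetilde B,\mathcal P)$ over $\widehat{\mathbb A}$ is the intersection of the rings $\widehat{\mathbb A}[\mathbf x^{\pm1}]$ of Laurent polynomials in cluster variables over all seeds. The exchange polynomials at a seed are coprime if the $N$ exchange polynomials (one for each direction) are pairwise coprime. **Nerves and upper bounds.** A nerve $\mathcal N$ is a subtree of $\mathbb T_N$ on $N+1$ vertices all of whose edges have different labels. The upper bound $\overline{\mathcal A}(\mathcal N)$ is the intersection of the rings $\widehat{\mathbb A}[\mathbf x^{\pm1}]$ over all seeds in $\mathcal N$.
   Formalization: The ground ring is additionally assumed to be a localization of A, i.e. A with some of the stable variables inverted; for an arbitrary subring between A and its Laurent ring, such as Z[x_4, x_3/x_4] in type A_2, the upper bounds can depend on the nerve. *)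

(* Defs.v *)
From HB Require Import structures.
From mathcomp Require Import all_boot all_order all_algebra.
From mathcomp Require Import finmap mpoly.

Set Implicit Arguments.
Unset Strict Implicit.
Unset Printing Implicit Defensive.

Import Order.TTheory GRing.Theory Num.Theory.

Local Open Scope ring_scope.

(** * Subrings of a field, as predicates *)

Section Subrings.
Variable F : fieldType.
Implicit Types (K : F -> Prop) (y : F).

Definition is_int y : Prop := exists z : int, y = z%:~R.

Definition is_subring K : Prop :=
  K 1 /\ (forall a b, K a -> K b -> K (a - b) /\ K (a * b)).

(* K[x_1, ..., x_n] *)
Definition poly_ring K n (x : 'I_n -> F) y : Prop :=
  exists p : {mpoly F[n]}, (forall m, K p@_m) /\ y = p.@[x].

(* K[x_1^{+-1}, ..., x_n^{+-1}] (only used for nonzero x_i) *)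
Definition laurent_ring K n (x : 'I_n -> F) y : Prop :=
  exists (p : {mpoly F[n]}) (m : 'X_{1..n}),
    (forall m', K p@_m') /\ y = p.@[x] / \prod_(i < n) x i ^+ m i.

Definition frac_field K y : Prop :=
  exists a b, [/\ K a, K b, b != 0 & y = a / b].

(* R2 is a ring of fractions of R1: every element of R2 is a fraction a / s
   with a, s in R1 and s invertible in R2.  For R1 = Z[x_{N+1}, ..., x_{N+M}]
   and R2 between R1 and its Laurent ring, this says that R2 is obtained from R1
   by inverting some of the stable variables. *)
Definition is_localization (R1 R2 : F -> Prop) : Prop :=
  forall y, R2 y -> exists a s, [/\ R1 a, R1 s, s != 0, R2 s^-1 & y = a / s].

(* x is a transcendence basis of F over its subfield K: it is algebraically
   independent over K, and F is algebraic over K(x). *)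
Definition transcendence_basis K n (x : 'I_n -> F) : Prop :=
  (forall p : {mpoly F[n]}, (forall m, K p@_m) -> p.@[x] = 0 -> p = 0) /\
  (forall y, exists p : {poly F},
     [/\ p != 0, forall i, frac_field (poly_ring K x) p`_i & root p y]).

End Subrings.

Definition coprime_elts (R : idomainType) (f g : R) : Prop :=
  forall h : R, (exists a, f = a * h) -> (exists b, g = b * h) ->
  h \is a GRing.unit.

(** * Seeds and mutations *)

(* Column [lshift M i] of an extended exchange matrix, and variable
   [lshift M i] of a polynomial in N + M variables, belong to the i-th cluster
   variable; index [rshift N j] belongs to the j-th stable variable. *)

Definition ratfun (N M : nat) : fieldType := {fraction {mpoly rat[N + M]}}.

Definition stable (N M : nat) (j : 'I_M) : ratfun N M :=
  tofrac ('X_(rshift N j) : {mpoly rat[N + M]}).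

Section Seeds.
Variables (N M : nat) (d : 'I_N -> nat).

Definition ringA : ratfun N M -> Prop :=
  poly_ring (@is_int (ratfun N M)) (@stable N M).

Definition ringAbar : ratfun N M -> Prop :=
  laurent_ring (@is_int (ratfun N M)) (@stable N M).

(* [strings i r] is the exponent vector of the monomial p_{i r}. *)
Record seed := Seed {
  cluster : 'I_N -> ratfun N M;
  exmat : 'M[int]_(N, N + M);
  strings : forall i : 'I_N, 'I_(d i).+1 -> 'X_{1..M} }.

(* The extended cluster. *)
Definition ext_cluster (S : seed) (i : 'I_(N + M)) : ratfun N M :=
  match split i with
  | inl a => cluster S a
  | inr j => stable N j
  end.

Section Exchange.
Variables (S : seed) (k : 'I_N).

Local Notation bc i := (exmat S k (lshift M i)).
Local Notation bs j := (exmat S k (rshift N j)).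
Local Notation xc i := ('X_(lshift M i) : {mpoly int[N + M]}).
Local Notation xs j := ('X_(rshift N j) : {mpoly int[N + M]}).

Definition u_gt : {mpoly int[N + M]} :=
  \prod_(i < N | 0 < bc i) xc i ^+ (`|bc i| %/ d k)%N.
Definition u_lt : {mpoly int[N + M]} :=
  \prod_(i < N | bc i < 0) xc i ^+ (`|bc i| %/ d k)%N.
Definition v_gt (r : nat) : {mpoly int[N + M]} :=
  \prod_(j < M | 0 < bs j) xs j ^+ ((r * `|bs j|) %/ d k)%N.
Definition v_lt (r : nat) : {mpoly int[N + M]} :=
  \prod_(j < M | bs j < 0) xs j ^+ ((r * `|bs j|) %/ d k)%N.

Definition string_mon (r : 'I_(d k).+1) : {mpoly int[N + M]} :=
  \prod_(j < M) xs j ^+ strings S r j.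

(* The exchange polynomial, as a formal polynomial: Z[x_1, ..., x_{N+M}] is
   A[x_1, ..., x_N], the cluster and stable variables being algebraically
   independent. *)
Definition exch_poly : {mpoly int[N + M]} :=
  \sum_(r < (d k).+1)
     string_mon r * u_gt ^+ r * v_gt r * u_lt ^+ (d k - r) * v_lt (d k - r).

Definition mut_cluster (i : 'I_N) : ratfun N M :=
  if i == k then mmap intr (ext_cluster S) exch_poly / cluster S k
  else cluster S i.

(* The numerator of the correction term is always even. *)
Definition mut_exmat : 'M[int]_(N, N + M) :=
  let B := exmat S in
  \matrix_(i, j)
    if (i == k) || (j == lshift M k) then - B i j
    else B i j + ((`|B i (lshift M k)| * B k j
                   + B i (lshift M k) * `|B k j|) %/ 2)%Z.

Definition mut_strings (i : 'I_N) (r : 'I_(d i).+1) : 'X_{1..M} :=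
  if i == k then strings S (rev_ord r) else strings S r.

Definition mutate : seed := Seed mut_cluster mut_exmat mut_strings.

End Exchange.

Definition mutate_seq (S : seed) (w : seq 'I_N) : seed :=
  foldr (fun k S' => mutate S' k) S w.

Definition skew_symmetrizable (B : 'M[int]_N) : Prop :=
  exists D : 'rV[int]_N,
    (forall i, 0 < D 0 i) /\ (diag_mx D *m B)^T = - (diag_mx D *m B).

(* The conditions on initial data; they are preserved by mutations. *)
Definition is_seed (S : seed) : Prop :=
  [/\ transcendence_basis (frac_field ringAbar) (cluster S),
      skew_symmetrizable (lsubmx (exmat S)),
      forall i : 'I_N, (0 < d i)%N
        /\ (d i %| \big[gcdn/0]_(j < N) `|exmat S i (lshift M j)|)%N
    & forall i : 'I_N, strings S (@ord0 (d i)) = 0%MM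
                    /\ strings S (@ord_max (d i)) = 0%MM].

Definition in_GC (S0 S : seed) : Prop :=
  exists w : seq 'I_N, S = mutate_seq S0 w.

Definition coprime_seed (S : seed) : Prop :=
  forall k l : 'I_N, k != l -> coprime_elts (exch_poly S k) (exch_poly S l).

End Seeds.

(** * The tree T_N, nerves and upper bounds *)

(* Vertices of the N-regular tree are the words in the N edge labels without
   two equal consecutive letters; the edge labelled k joins w and k :: w. *)

Record tvertex (N : nat) := TVertex {
  tword :> seq 'I_N;
  _ : sorted (fun a b => a != b) tword }.

HB.instance Definition _ N := [isSub for @tword N].
HB.instance Definition _ N := [Choice of tvertex N by <:].

Definition tedge (N : nat) (k : 'I_N) (u v : tvertex N) : bool :=
  (tword u == k :: tword v) || (tword v == k :: tword u).

Definition tadj (N : nat) (u v : tvertex N) : bool := [exists k, tedge k u v].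

Definition is_nerve (N : nat) (V : {fset tvertex N}) : Prop :=
  [/\ #|` V| = N.+1,
      forall u v, u \in V -> v \in V ->
        exists p : seq (tvertex N),
          [/\ path (@tadj N) u p, all (mem V) p & last u p = v]
    & forall (k : 'I_N) (u v u' v' : tvertex N),
        u \in V -> v \in V -> u' \in V -> v' \in V ->
        tedge k u v -> tedge k u' v' ->
        (u' = u /\ v' = v) \/ (u' = v /\ v' = u)].

Section Bounds.
Variables (N M : nat) (d : 'I_N -> nat).
Variables (Ahat : ratfun N M -> Prop) (S0 : seed M d).

(* S0 sits at the empty word.  As mutations in a fixed direction are
   involutive, both ends of an edge labelled k carry seeds that are adjacent to
   each other in direction k. *)
Definition seed_at (v : tvertex N) : seed M d := mutate_seq S0 (tword v).

Definition upper_algebra (y : ratfun N M) : Prop :=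
  forall S, in_GC S0 S -> laurent_ring Ahat (cluster S) y.

Definition upper_bound (V : {fset tvertex N}) (y : ratfun N M) : Prop :=
  forall v, v \in V -> laurent_ring Ahat (cluster (seed_at v)) y.

End Bounds.

(* Main.v *)
Require Import Defs.
From HB Require Import structures.
From mathcomp Require Import all_boot all_order all_algebra.
From mathcomp Require Import finmap mpoly ring zify.
From Stdlib Require Import Classical FunctionalExtensionality.

(** The theorem reduces to a statement about two mutations. Let S be a seed, k
   and l two directions, and write L(S) for the Laurent ring of S. Then
   everything in L(S) and in L(mu_l mu_k S) lies in L(mu_l S)
   ([laurent_step]).

   In a nerve, this lets the property of lying in L(S) and in L(mu_l S) pass
   from one end S of an edge labelled k to the other end. It holds at the ends
   of the edge labelled l, and each label occurs in a nerve because there are as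
   many edges as labels ([nerve_label]). So an element of the upper bound lies
   in the Laurent rings of all neighbours of a seed of the nerve
   ([upper_bound_star]). The same step, read at a neighbour, carries this star
   condition to every seed of the tree ([laurent_star_cons]), and the upper bound
   is the upper cluster algebra.

   To prove the step, put T = L(mu_l S), let q be the value of the exchange
   polynomial Q of S in direction l, z the variable that mu_l replaces, and w the
   new one, so that z = q / w. An element y of L(S) becomes an element of T when
   multiplied by a power of q. The cluster of mu_l mu_k S consists of units of T
   and of two further variables: the variable x obtained at S in direction k, and
   the variable z' obtained at mu_k S in direction l. Both lie in T, so y in
   L(mu_l mu_k S) also becomes an element of T when multiplied by a power of a
   product of x, z' and units. If x and z' are non-zero-divisors modulo q, the
   two denominators have nothing in common, and y is in T
   ([regular_denominators]).

   That x is regular ([regular_exchange1]): up to a unit, x is the exchange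
   polynomial P in direction k. If P does not involve z, then P and Q are coprime
   polynomials, and since Z[x_1, ..., x_n] is factorial ([factorial_mpoly_int],
   by Gauss's lemma) P is regular modulo Q. If P involves z, then P is modulo z,
   hence modulo q, a monomial, and Q is divisible by no variable because its first
   and last terms have disjoint supports and all its coefficients are positive
   ([kill_exch_neq0]).

   That z' is regular ([regular_exchange2]): if P does not involve z, then z' = w
   is a unit. Otherwise substitute x = P / x_k in the exchange polynomial of
   mu_k S in direction l. Its value at z = 0 is q times a monomial, up to a unit:
   this is where matrix mutation enters, and the floors in the exponents of the
   stable variables cause no loss because the entry (l, k) is divisible by d_l
   ([term_exp_mut], [ev_exch_subst]). Dividing by z turns that monomial multiple
   of q into a monomial multiple of w, so that z' is, modulo q and up to a unit,
   a polynomial of degree one in w whose leading coefficient is a monomial and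
   whose other coefficient does not involve w. Comparing coefficients of powers
   of w shows that it is regular ([dvd_mul_affine]).

   All these arguments use polynomials with integer coefficients; they apply to T
   because a ground ring that is a localization of Z[x_{N+1}, ..., x_{N+M}] makes
   T a localization of the ring of polynomials in the extended cluster
   ([laurent_localization]), and because the extended cluster stays algebraically
   independent under mutation ([seed_inv_mutate]). *)

Set Implicit Arguments.
Unset Strict Implicit.
Unset Printing Implicit Defensive.

Import Order.TTheory GRing.Theory Num.Theory.

Local Open Scope ring_scope.

(** * Unique factorization in Z[x_1, ..., x_n] *)

Section Divisibility.
Variable R : idomainType.
Implicit Types (a b c f g p u : R) (s : seq R).

Definition divides a b : Prop := exists c, b = c * a.

Definition prime_elt p : Prop :=
  [/\ p != 0, p \isn't a GRing.unit
    & forall a b, divides p (a * b) -> divides p a \/ divides p b].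

Definition all_prime s : Prop := forall p, p \in s -> prime_elt p.

Lemma dvdxx a : divides a a. Proof. by exists 1; rewrite mul1r. Qed.

Lemma dvd_mull a b c : divides a b -> divides a (c * b).
Proof. by case=> x ->; exists (c * x); rewrite mulrA. Qed.

Lemma dvd_mulr a b c : divides a b -> divides a (b * c).
Proof. by rewrite mulrC; apply: dvd_mull. Qed.

Lemma dvd0 a : divides a 0. Proof. by exists 0; rewrite mul0r. Qed.

Lemma dvdD a b c : divides a b -> divides a c -> divides a (b + c).
Proof. by case=> x -> [y ->]; exists (x + y); rewrite mulrDl. Qed.

Lemma dvdN a b : divides a b -> divides a (- b).
Proof. by case=> x ->; exists (- x); rewrite mulNr. Qed.

Lemma dvdB a b c : divides a b -> divides a c -> divides a (b - c).
Proof. by move=> ab /dvdN; apply: dvdD. Qed.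

Lemma dvd_trans a b c : divides a b -> divides b c -> divides a c.
Proof. by case=> x -> [y ->]; exists (y * x); rewrite mulrA. Qed.

Lemma dvd_mem_prod p s : p \in s -> divides p (\prod_(q <- s) q).
Proof.
elim: s => // q s IHs; rewrite inE big_cons => /orP[/eqP->|/IHs].
  exact/dvd_mulr/dvdxx.
exact: dvd_mull.
Qed.

Lemma all_prime_cons p s : all_prime (p :: s) -> prime_elt p /\ all_prime s.
Proof.
by move=> ps; split=> [|q qs]; apply: ps; rewrite inE ?eqxx ?qs ?orbT.
Qed.

Lemma prod_all_prime_neq0 s : all_prime s -> \prod_(q <- s) q != 0.
Proof.
elim: s => [|p s IHs]; first by rewrite big_nil oner_eq0.
by case/all_prime_cons=> -[p0 _ _] /IHs s0; rewrite big_cons mulf_neq0.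
Qed.

Lemma prime_dvd_prime p q :
  prime_elt p -> prime_elt q -> divides p q -> divides q p.
Proof.
move=> [p0 pu pp] [q0 qu pq] [t qE].
have /pq[] : divides q (t * p) by rewrite -qE; apply: dvdxx.
  case=> w tE; case/negP: pu; apply/unitrPr; exists w.
  by apply: (mulfI q0); rewrite mulr1 [RHS]qE tE; ring.
by [].
Qed.

Lemma prime_dvd_prod p u s : prime_elt p -> u \is a GRing.unit ->
  divides p (u * \prod_(q <- s) q) -> exists2 q, q \in s & divides p q.
Proof.
move=> pp uu; have [_ pu pM] := pp.
elim: s => [|q s IHs].
  rewrite big_nil mulr1 => -[c uE]; case/negP: pu.
  by move: uu; rewrite uE unitrM => /andP[].
rewrite big_cons mulrCA => /pM[pq|/IHs[r rs pr]].
  by exists q; rewrite ?inE ?eqxx.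
by exists r; rewrite // inE rs orbT.
Qed.

(** Peel the primes off one at a time: a prime that divides [g * h] but not [g]
   divides [h]. *)
Lemma dvd_prod_primes u s g h : u \is a GRing.unit -> all_prime s ->
    (forall p, p \in s -> ~ divides p g) ->
  divides (u * \prod_(q <- s) q) (g * h) -> divides (u * \prod_(q <- s) q) h.
Proof.
move=> uu; elim: s h => [|p s IHs] h.
  rewrite big_nil mulr1 => _ _ _.
  by exists (h / u); rewrite -mulrA mulVr ?mulr1.
move=> /all_prime_cons[[p0 pu pp] ps] ng; rewrite big_cons mulrCA => pgh.
have /pp[/ng|[h' hE]] : divides p (g * h).
- by apply: dvd_trans pgh; apply/dvd_mulr/dvdxx.
- by rewrite inE eqxx => /(_ isT).
have [c] : divides (u * \prod_(q <- s) q) h'.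
  apply: IHs => // [q qs|]; first by apply: ng; rewrite inE qs orbT.
  case: pgh => c cE; exists c; apply: (mulfI p0).
  by transitivity (g * h); [rewrite hE | rewrite cE]; ring.
by rewrite hE => ->; exists c; ring.
Qed.

Definition factorial_ring : Prop :=
  forall a, a != 0 -> exists u s,
    [/\ u \is a GRing.unit, all_prime s & a = u * \prod_(q <- s) q].

(** Divisor-wise coprimality, which only speaks about common factors, becomes
   Euclid's lemma as soon as factorizations into primes exist. *)
Lemma coprime_dvd f g h : factorial_ring -> f != 0 ->
  coprime_elts f g -> divides f (g * h) -> divides f h.
Proof.
move=> fac f0; have [u [s [uu ps ->]]] := fac f f0 => cop.
apply: dvd_prod_primes => // p ip pg.
have [_ pu _] := ps p ip; case/negP: pu; apply: cop => //.
by case: (dvd_mull u (dvd_mem_prod ip)) => c ->; exists c.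
Qed.

End Divisibility.

Lemma factorial_transfer (A B : idomainType) (f : A -> B) (g : B -> A) :
    f 0 = 0 -> f 1 = 1 -> {morph f : x y / x * y} -> cancel f g -> cancel g f ->
  factorial_ring B -> factorial_ring A.
Proof.
move=> f0 f1 fM fK gK facB a a0.
have f_inj := can_inj fK.
have dvdE x y : divides x y <-> divides (f x) (f y).
  split=> [[c ->]|[c e]]; first by exists (f c).
  by exists (g c); apply: f_inj; rewrite fM gK.
have f_eq0 x : (f x == 0) = (x == 0) by rewrite -f0 (inj_eq f_inj).
have unitE x : (f x \is a GRing.unit) = (x \is a GRing.unit).
  apply/idP/idP => /unitrP[y [_ xy]]; apply/unitrPr.
    by exists (g y); apply: f_inj; rewrite fM gK f1.
  by exists (f y); rewrite -fM xy.
have fa0 : f a != 0 by rewrite f_eq0.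
have [u [s [uu ps fa]]] := facB (f a) fa0.
exists (g u), (map g s); split.
- by rewrite -unitE gK.
- move=> _ /mapP[p /ps[p0 pu pp] ->]; split.
  + by rewrite -f_eq0 gK.
  + by rewrite -unitE gK.
  + by move=> x y; rewrite !dvdE fM gK => /pp.
- apply: f_inj; rewrite fa fM gK big_map (big_morph f fM f1); congr (_ * _).
  by apply: eq_bigr => i _; rewrite gK.
Qed.

Lemma factorial_int : factorial_ring int.
Proof.
have prime_int (p : nat) : prime p -> prime_elt (p : int).
  move=> pp; split.
  - by rewrite eqz_nat -lt0n prime_gt0.
  - by apply: contraL (prime_gt1 pp) => /orP[/eqP[->]|/eqP].
  have dvdE (a b : int) : divides a b <-> (a %| b)%Z.
    by split=> [[c ->]|/dvdzP[c ->]]; [apply: dvdz_mull | exists c].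
  by move=> a b; rewrite !dvdE !dvdzE abszM /= Euclid_dvdM // => /orP.
have nat_fac (n : nat) : (0 < n)%N -> exists s : seq int,
    all_prime s /\ (n : int) = \prod_(q <- s) q.
  elim: n {-2}n (leqnn n) => [|m IHm] n lenm n0.
    by move: n0; rewrite ltnNge lenm.
  have [n1|n1] := leqP n 1.
    exists [::]; split=> //; rewrite big_nil.
    by have /eqP-> : n == 1%N by rewrite eqn_leq n1.
  have pp := pdiv_prime n1; have /dvdnP[k nE] := pdiv_dvd n.
  have k0 : (0 < k)%N by move: n0; rewrite nE muln_gt0 => /andP[].
  have [|s [ps kE]] := IHm k _ k0.
    rewrite -ltnS (leq_trans _ lenm) // [X in (_ < X)%N]nE.
    by rewrite ltn_Pmulr ?prime_gt1.
  exists ((pdiv n : int) :: s); split.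
    by move=> q; rewrite inE => /orP[/eqP->|/ps//]; apply: prime_int.
  by rewrite big_cons -kE {1}nE PoszM mulrC.
move=> a a0.
have a_gt0 : (0 < `|a|)%N by rewrite absz_gt0.
have [s [ps aE]] := nat_fac `|a|%N a_gt0.
exists (sgz a), s; split=> //; last by rewrite -aE abszE {1}[a]intEsg.
by case: a a0 {a_gt0 aE} => [[|n]|n].
Qed.

(** * Gauss's lemma *)

Section Gauss.
Variable R : idomainType.
Implicit Types (f g h : {poly R}) (p c : R).

Lemma dvd_polyC p q : divides p q -> divides p%:P q%:P.
Proof. by case=> c ->; exists c%:P; rewrite polyCM. Qed.

Lemma dvd_polyC_coef p f i : divides p%:P f -> divides p f`_i.
Proof. by case=> g ->; exists g`_i; rewrite coefMC. Qed.

(** Modulo [p] the ring [R] is a domain, so the product of two polynomials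
   not divisible by [p] keeps a nonzero leading term once the leading terms
   divisible by [p] are removed. *)
Lemma prime_polyC p : prime_elt p -> prime_elt p%:P.
Proof.
move=> [p0 pu pp]; split; first by rewrite polyC_eq0.
  by rewrite poly_unitE size_polyC p0 coefC eqxx.
have main n : forall f g, (size f + size g <= n)%N ->
    divides p%:P (f * g) -> divides p%:P f \/ divides p%:P g.
  elim: n => [|n IHn] f g.
    rewrite leqn0 addn_eq0 size_poly_eq0 => /andP[/eqP-> _] _.
    by left; apply: dvd0.
  have [->|f0] := eqVneq f 0; first by move=> _ _; left; apply: dvd0.
  have [->|g0] := eqVneq g 0; first by move=> _ _; right; apply: dvd0.
  have trunc h : h != 0 -> exists2 h' : {poly R}, (size h' < size h)%N &
      h = h' + (lead_coef h)%:P * 'X^((size h).-1).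
    move=> h0; exists (h - (lead_coef h)%:P * 'X^((size h).-1)).
      have sh : (0 < size h)%N by rewrite size_poly_gt0.
      rewrite -[X in (_ < X)%N](prednK sh) ltnS; apply/leq_sizeP => j.
      rewrite leq_eqVlt coefB coefCM coefXn => /orP[/eqP<-|lt].
        by rewrite eqxx mulr1 subrr.
      rewrite gtn_eqF // mulr0 subr0 nth_default //.
      by rewrite -(prednK sh).
    by rewrite subrK.
  move=> sz dfg.
  have /pp[pf|pg] : divides p (lead_coef f * lead_coef g).
  - by rewrite -lead_coefM; apply: dvd_polyC_coef.
  - have [f' sf' fE] := trunc f f0.
    have df : divides p%:P ((lead_coef f)%:P * 'X^((size f).-1)).
      exact/dvd_mulr/dvd_polyC.
    case: (IHn f' g).
    + by rewrite -ltnS (leq_trans _ sz) // ltn_add2r.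
    + have -> : f' = f - (lead_coef f)%:P * 'X^((size f).-1).
        by rewrite {1}fE addrK.
      by rewrite mulrBl; apply: dvdB => //; apply: dvd_mulr.
    + by move=> df'; left; rewrite fE; apply: dvdD.
    + by right.
  - have [g' sg' gE] := trunc g g0.
    have dg : divides p%:P ((lead_coef g)%:P * 'X^((size g).-1)).
      exact/dvd_mulr/dvd_polyC.
    case: (IHn f g').
    + by rewrite -ltnS (leq_trans _ sz) // ltn_add2l.
    + have -> : g' = g - (lead_coef g)%:P * 'X^((size g).-1).
        by rewrite {1}gE addrK.
      by rewrite mulrBr; apply: dvdB => //; apply: dvd_mull.
    + by left.
    + by move=> dg'; right; rewrite gE; apply: dvdD.
by move=> f g; apply: (main (size f + size g)%N).
Qed.

Lemma all_prime_polyC (s : seq R) :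
  all_prime s -> all_prime [seq p%:P | p <- s].
Proof. by move=> ps _ /mapP[p /ps pp ->]; apply: prime_polyC. Qed.

Lemma prod_polyC (s : seq R) :
  \prod_(q <- [seq p%:P | p <- s]) q = (\prod_(q <- s) q)%:P :> {poly R}.
Proof. by rewrite big_map rmorph_prod. Qed.

Lemma size1_polyC_neq0 f : size f = 1%N -> exists2 e, e != 0 & f = e%:P.
Proof.
move=> s1; have fE : f = (f`_0)%:P by apply: size1_polyC; rewrite s1.
by exists f`_0 => //; rewrite -polyC_eq0 -fE -size_poly_gt0 s1.
Qed.

Definition primitive f : Prop := forall p, prime_elt p -> ~ divides p%:P f.

Hypothesis facR : factorial_ring R.

Lemma primitive_dvd_polyC c f h : c != 0 -> primitive f ->
  divides f (c%:P * h) -> divides f h.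
Proof.
move=> c0 pf [w wE].
have [u [s [uu ps cE]]] := facR c0.
suff [w' w'E] : divides c%:P w.
  exists w'; have cP : c%:P != 0 by rewrite polyC_eq0.
  by apply: (mulfI cP); rewrite wE w'E mulrCA mulrA.
have := @dvd_prod_primes _ u%:P [seq p%:P | p <- s] f w.
rewrite prod_polyC -polyCM -cE; apply.
- exact: rmorph_unit.
- exact: all_prime_polyC.
- by move=> _ /mapP[p /ps pp ->]; apply: pf.
- by exists h; rewrite mulrC -wE mulrC.
Qed.

(** Factorizations over the field of fractions descend to [R]: a prime of the
   cleared denominator divides one of the two factors. *)
Lemma primitive_factor c f g h : c != 0 -> c%:P * f = g * h ->
  exists g' h', [/\ f = g' * h', size g' = size g & size h' = size h].
Proof.
move=> c0; have [u [s [uu ps ->]]] := facR c0.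
elim: s g h ps => [|p s IHs] g h.
  rewrite big_nil mulr1 => _ e; exists (u^-1%:P * g), h; split=> //.
    by rewrite -mulrA -e mulrA -polyCM mulVr // mul1r.
  by rewrite size_Cmul // invr_eq0; apply: contraTneq uu => ->; rewrite unitr0.
case/all_prime_cons=> pp ps; rewrite big_cons mulrCA polyCM -mulrA => e.
have [p0 _ pM] := prime_polyC pp.
have p00 : p != 0 by rewrite -polyC_eq0.
have /pM[[g1 gE]|[h1 hE]] : divides p%:P (g * h).
- by rewrite -e; apply/dvd_mulr/dvdxx.
- have e1 : (u * \prod_(q <- s) q)%:P * f = g1 * h.
    by apply: (mulfI p0); rewrite e gE; ring.
  have [g' [h' [-> sg sh]]] := IHs g1 h ps e1.
  by exists g', h'; split=> //; rewrite sg gE mulrC size_Cmul.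
- have e1 : (u * \prod_(q <- s) q)%:P * f = g * h1.
    by apply: (mulfI p0); rewrite e hE; ring.
  have [g' [h' [-> sg sh]]] := IHs g h1 ps e1.
  by exists g', h'; split=> //; rewrite sh hE mulrC size_Cmul.
Qed.

(** Walk once through the primes of the leading coefficient: every constant
   prime dividing [f] is associated with one of them. *)
Lemma primitive_part f : f != 0 -> exists s f',
  [/\ all_prime s, primitive f' & f = (\prod_(q <- s) q)%:P * f'].
Proof.
move=> f0; have lf0 : lead_coef f != 0 by rewrite lead_coef_eq0.
have [u [s [uu ps lfE]]] := facR lf0.
suff main t g : all_prime t -> g != 0 ->
    (forall q, q \in t -> ~ divides q%:P g) ->
    lead_coef g = u * (\prod_(q <- s) q) * \prod_(q <- t) q ->
    exists s f',
      [/\ all_prime s, primitive f' & g = (\prod_(q <- s) q)%:P * f'].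
  by apply: (main [::]) => //; rewrite big_nil mulr1.
elim: s t g ps {lfE} => [|q s IHs] t g.
  move=> _ pt g0 ndv; rewrite big_nil mulr1 => lgE.
  exists [::], g; split=> // [p pp pg|]; last by rewrite big_nil mul1r.
  have [|q qt pq] := @prime_dvd_prod _ p u t pp uu.
    by rewrite -lgE /lead_coef; apply: dvd_polyC_coef.
  apply: (ndv q qt); apply: dvd_trans pg; apply: dvd_polyC.
  exact: prime_dvd_prime pp (pt q qt) pq.
case/all_prime_cons=> pq ps pt g0 ndv; rewrite big_cons => lgE.
have [[g1 gE]|nqg] := classic (divides q%:P g); last first.
  apply: (IHs (q :: t)) => //.
  - by move=> r; rewrite inE => /orP[/eqP->|/pt].
  - by move=> r; rewrite inE => /orP[/eqP->|/ndv].
  - by rewrite lgE big_cons; ring.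
have [q0 _ _] := pq.
have g10 : g1 != 0 by apply: contraNneq g0 => g10; rewrite gE g10 mul0r.
have [||r [f' [pr pf g1E]]] := IHs t g1 ps pt g10.
- move=> r rt rg1; apply: (ndv r rt); rewrite gE; exact: dvd_mulr.
- apply: (mulIf q0); have := lgE; rewrite gE lead_coefM lead_coefC => ->.
  by ring.
exists (q :: r), f'; split=> //.
  by move=> r'; rewrite inE => /orP[/eqP->|/pr].
by rewrite big_cons polyCM gE g1E; ring.
Qed.

(** Without a factorization into polynomials of smaller degree, [f] generates
   with any [a] either a multiple of [a] or a nonzero constant, by the
   Euclidean algorithm over the field of fractions. *)
Lemma primitive_prime f : primitive f -> (1 < size f)%N ->
    ~ (exists g h, [/\ f = g * h, (size g < size f)%N & (size h < size f)%N]) ->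
  prime_elt f.
Proof.
move=> pf sf nfac; have f0 : f != 0 by rewrite -size_poly_gt0 ltnW.
split=> //; first by rewrite poly_unitE gtn_eqF.
move=> a b [w abE]; pose g := gcdp f a.
have [[c q] /= c0 cE] := Pdiv.Idomain.dvdpP _ _ (dvdp_gcdl f a).
rewrite -/g in cE.
have [[c' q'] /= c'0 c'E] := Pdiv.Idomain.dvdpP _ _ (dvdp_gcdr f a).
rewrite -/g in c'E.
have cE' : c%:P * f = q * g by rewrite mul_polyC.
have [g' [h' [fE sg sh]]] := primitive_factor c0 cE'.
have g'0 : g' != 0 by apply: contraNneq f0 => e; rewrite fE e mul0r.
have h'0 : h' != 0 by apply: contraNneq f0 => e; rewrite fE e mulr0.
have szf : size f = (size g' + size h').-1 by rewrite fE size_mul.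
move: (g'0) (h'0); rewrite -!size_poly_gt0 => sg0 sh0.
have [s1|s1] : size g' = 1%N \/ size h' = 1%N.
  apply: NNPP => ns; apply: nfac; exists g', h'; split=> //; rewrite szf; lia.
(* the gcd is f up to a constant, so f divides a constant multiple of a *)
- left; have [e e0 qE] : exists2 e, e != 0 & q = e%:P.
    by apply: size1_polyC_neq0; rewrite -sg.
  apply: (@primitive_dvd_polyC (e * c')) => //; first exact: mulf_neq0.
  exists (q' * c%:P); rewrite polyCM -mulrA [c'%:P * a]mul_polyC c'E.
  by rewrite -mulrA cE' qE; ring.
(* the gcd is a constant, so f divides a constant multiple of b *)
- right; have [[u v] /eqpP[[c1 c2] /= /andP[c10 c20] uvE]] := Bezoutp f a.
  rewrite -/g in uvE.
  have [e e0 gE] : exists2 e, e != 0 & g = e%:P.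
    by apply: size1_polyC_neq0; rewrite -sh.
  have uvE' : c1%:P * (u * f + v * a) = (c2 * e)%:P.
    by rewrite mul_polyC uvE gE -mul_polyC polyCM.
  apply: (@primitive_dvd_polyC (c2 * e)) => //; first exact: mulf_neq0.
  exists (c1%:P * (u * b + v * w)); rewrite -uvE'.
  transitivity (c1%:P * (u * f * b + v * (a * b))); first by ring.
  by rewrite abE; ring.
Qed.

Lemma factorial_poly : factorial_ring {poly R}.
Proof.
suff main n : forall f, f != 0 -> (size f <= n)%N -> exists u s,
    [/\ u \is a GRing.unit, all_prime s & f = u * \prod_(q <- s) q].
  by move=> f f0; apply: (main (size f)).
elim: n => [|n IHn] f f0.
  by rewrite leqn0 size_poly_eq0 (negbTE f0).
move=> sf; have [s [g [ps pg fE]]] := primitive_part f0.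
suff [u [t [uu pt gE]]] : exists u t,
    [/\ u \is a GRing.unit, all_prime t & g = u * \prod_(q <- t) q].
  exists u, ([seq q%:P | q <- s] ++ t); split=> //.
    by move=> p; rewrite mem_cat => /orP[/all_prime_polyC|]; [apply|apply: pt].
  by rewrite big_cat /= prod_polyC fE gE; ring.
have c0 : \prod_(q <- s) q != 0 by apply: prod_all_prime_neq0.
have g0 : g != 0 by apply: contraNneq f0 => e; rewrite fE e mulr0.
have sg : size g = size f by rewrite fE size_Cmul.
have [s1|s1] := leqP (size g) 1.
  have gE := size1_polyC s1.
  have e0 : g`_0 != 0 by apply: contraNneq g0 => e; rewrite gE e.
  have [u [t [uu pt eE]]] := facR e0.
  exists u%:P, [seq q%:P | q <- t]; split=> //.
  - exact: rmorph_unit.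
  - exact: all_prime_polyC.
  - by rewrite prod_polyC -polyCM -eE.
have [[h1 [h2 [gE s2 s3]]]|nfac] := classic (exists h1 h2,
    [/\ g = h1 * h2, (size h1 < size g)%N & (size h2 < size g)%N]); last first.
  exists 1, [:: g]; split; first exact: unitr1.
    by move=> p; rewrite inE => /eqP->; apply: primitive_prime.
  by rewrite big_seq1 mul1r.
have h10 : h1 != 0 by apply: contraNneq g0 => e; rewrite gE e mul0r.
have h20 : h2 != 0 by apply: contraNneq g0 => e; rewrite gE e mulr0.
have [|u1 [t1 [uu1 pt1 h1E]]] := IHn h1 h10.
  by rewrite -ltnS (leq_trans s2) // sg.
have [|u2 [t2 [uu2 pt2 h2E]]] := IHn h2 h20.
  by rewrite -ltnS (leq_trans s3) // sg.
exists (u1 * u2), (t1 ++ t2); split.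
- by rewrite unitrM uu1.
- by move=> p; rewrite mem_cat => /orP[/pt1|/pt2].
- by rewrite big_cat /= gE h1E h2E; ring.
Qed.
End Gauss.

(** * Polynomials in several variables *)

Lemma mpoly_gen_ind n (Q : {mpoly int[n]} -> Prop) :
    (forall c, Q c%:MP) -> (forall i, Q 'X_i) ->
    (forall f g, Q f -> Q g -> Q (f + g)) ->
    (forall f g, Q f -> Q g -> Q (f * g)) ->
  forall f, Q f.
Proof.
move=> QC QX QD QM; elim/mpolyind => [|c m f _ _ Qf]; first by rewrite -mpolyC0.
apply: (QD) => //; rewrite -mul_mpolyC; apply: (QM) => //.
rewrite mpolyXE_id; elim/big_ind: _ => [||i _].
- by rewrite -mpolyC1.
- exact: QM.
elim: (m i) => [|k IHk]; first by rewrite expr0 -mpolyC1.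
by rewrite exprS; apply: (QM).
Qed.

Lemma muni_var n (i : 'I_n.+1) : muni ('X_i : {mpoly int[n.+1]}) =
  match split (cast_ord (esym (addn1 n)) i) with
  | inl j => ('X_j)%:P | inr _ => 'X end.
Proof. by rewrite /muni mmapX mmap1U. Qed.

Lemma muni_mwiden n (c : {mpoly int[n]}) : muni (mwiden c) = c%:P.
Proof.
elim/mpoly_gen_ind: c => [c|i|p q ep eq|p q ep eq].
- by rewrite mwidenC muniC.
- rewrite mwidenX mnmwiden1 muni_var; case: splitP => j /= ij.
    by congr ('X_(_))%:P; apply: val_inj.
  by have := ltn_ord i; rewrite ij ord1 addn0 ltnn.
- by rewrite mwidenD muniD ep eq polyCD.
- by rewrite mwidenM muniM ep eq polyCM.
Qed.

(** Viewing the last variable as the variable of a univariate polynomial is a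
   ring isomorphism. *)
Lemma mpolyS_poly_iso n :
  exists (f : {mpoly int[n.+1]} -> {poly {mpoly int[n]}})
         (g : {poly {mpoly int[n]}} -> {mpoly int[n.+1]}),
  [/\ f 0 = 0, f 1 = 1, {morph f : p q / p * q}, cancel f g & cancel g f].
Proof.
have [f [f0 f1 fD fM [fX fw]]] :
  exists f : {mpoly int[n.+1]} -> {poly {mpoly int[n]}},
    [/\ f 0 = 0, f 1 = 1, {morph f : p q / p + q}, {morph f : p q / p * q} &
     (forall i, f 'X_i = match split (cast_ord (esym (addn1 n)) i) with
                         | inl j => ('X_j)%:P | inr _ => 'X end) /\
     (forall c, f (mwiden c) = c%:P)].
  exists (@muni n int); split.
  - exact: muni0.
  - exact: muni1.
  - exact: muniD.
  - exact: muniM.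
  - by split; [apply: muni_var | apply: muni_mwiden].
have [g [gD gM gC gX]] : exists g : {poly {mpoly int[n]}} -> {mpoly int[n.+1]},
    [/\ {morph g : p q / p + q}, {morph g : p q / p * q},
        forall c, g c%:P = mwiden c & g 'X = 'X_ord_max].
  exists (fun p => (map_poly (@mwiden n int) p).['X_ord_max]); split.
  - by move=> p q; rewrite rmorphD hornerD.
  - by move=> p q; rewrite rmorphM hornerM.
  - by move=> c; rewrite map_polyC hornerC.
  - by rewrite map_polyX hornerX.
exists f, g; split=> //.
- elim/mpoly_gen_ind => [c|i|p q ep eq|p q ep eq].
  + by rewrite -mwidenC fw gC.
  + rewrite fX; case: splitP => j ij.
      by rewrite gC mwidenX mnmwiden1; congr 'X_(_); apply: val_inj.
    rewrite gX; congr 'X_(_); apply: val_inj.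
    by move: ij; rewrite /= ord1 addn0 => ->.
  + by rewrite fD gD ep eq.
  + by rewrite fM gM ep eq.
- elim/poly_ind => [|p c IHp].
    by rewrite -polyC0 gC mwiden0 f0.
  rewrite gD gM fD fM IHp gC fw gX fX; congr (_ * _ + _).
  case: splitP => // j /= ij.
  by have := ltn_ord j; rewrite -ij ltnn.
Qed.

Lemma factorial_mpoly_int n : factorial_ring {mpoly int[n]}.
Proof.
elim: n => [|n IHn].
  apply: (@factorial_transfer {mpoly int[0]} int (mcoeff 0%MM) (@mpolyC 0 int)).
  - exact: mcoeff0.
  - by rewrite mcoeff1 eqxx.
  - exact: (rmorphM (mcoeff 0%MM : {mpoly int[0]} -> int)).
  - exact: mpolyKC.
  - exact: mpolyCK.
  - exact: factorial_int.
have [f [g [f0 f1 fM fK gK]]] := mpolyS_poly_iso n.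
apply: (factorial_transfer f0 f1 fM fK gK).
exact: factorial_poly.
Qed.

(** * Evaluation of integer polynomials *)

(** Locked: comparing two values of the unlocked evaluation by conversion would
   unfold the construction of polynomials. *)
HB.lock Definition ev n (S : comRingType) (v : 'I_n -> S) :
  {mpoly int[n]} -> S := mmap intr v.

Lemma evE n (S : comRingType) (v : 'I_n -> S) : mmap intr v =1 ev v.
Proof. by move=> p; rewrite ev.unlock. Qed.

Lemma ev_is_zmod_morphism n (S : comRingType) (v : 'I_n -> S) :
  zmod_morphism (ev v).
Proof. by move=> p q; rewrite -!evE mmapB. Qed.

Lemma ev_is_monoid_morphism n (S : comRingType) (v : 'I_n -> S) :
  monoid_morphism (ev v).
Proof. by split=> [|p q]; rewrite -!evE (rmorph1, rmorphM). Qed.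

HB.instance Definition _ n (S : comRingType) (v : 'I_n -> S) :=
  GRing.isZmodMorphism.Build _ _ (ev v) (ev_is_zmod_morphism v).
HB.instance Definition _ n (S : comRingType) (v : 'I_n -> S) :=
  GRing.isMonoidMorphism.Build _ _ (ev v) (ev_is_monoid_morphism v).

Section Evaluation.
Variables (n : nat) (S : comRingType).
Implicit Types (v w : 'I_n -> S) (p : {mpoly int[n]}).

Lemma evC v c : ev v c%:MP = c%:~R.
Proof. by rewrite -evE mmapC. Qed.

Lemma evX v i : ev v 'X_i = v i.
Proof. by rewrite -evE mmapX mmap1U. Qed.

End Evaluation.

Section EvaluationMorphism.
Variables (n : nat) (S : comRingType).
Implicit Types (v w : 'I_n -> S) (p : {mpoly int[n]}).

Lemma morph_ev (S' : comRingType) (f : {rmorphism S -> S'}) v p :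
  f (ev v p) = ev (f \o v) p.
Proof.
elim/mpoly_gen_ind: p => [c|i|p q ep eq|p q ep eq].
- by rewrite !evC rmorph_int.
- by rewrite !evX.
- by rewrite !rmorphD ep eq.
- by rewrite !rmorphM ep eq.
Qed.

Lemma eq_ev v w p : v =1 w -> ev v p = ev w p.
Proof.
move=> vw; elim/mpoly_gen_ind: p => [c|i|p q ep eq|p q ep eq].
- by rewrite !evC.
- by rewrite !evX.
- by rewrite !rmorphD /= ep eq.
- by rewrite !rmorphM /= ep eq.
Qed.

Lemma ev_id p : ev (fun i => 'X_i) p = p.
Proof.
elim/mpoly_gen_ind: p => [c|i|p q ep eq|p q ep eq].
- by rewrite evC -[c in RHS]intz raddfMz.
- by rewrite evX.
- by rewrite rmorphD /= ep eq.
- by rewrite rmorphM /= ep eq.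
Qed.

End EvaluationMorphism.

Lemma ev_ev n m (S : comRingType) (w : 'I_n -> {mpoly int[m]}) (v : 'I_m -> S)
    (p : {mpoly int[n]}) :
  ev v (ev w p) = ev (fun i => ev v (w i)) p.
Proof. exact: (morph_ev (ev v)). Qed.

(** * Subrings *)

Section SubringPred.
Variables (S : comRingType) (K : S -> Prop).

(** [is_subring] for rings that need not be fields; on a field both are the same
   proposition. *)
Definition subring_pred : Prop :=
  K 1 /\ (forall a b, K a -> K b -> K (a - b) /\ K (a * b)).

Hypothesis sK : subring_pred.

Lemma subring1 : K 1. Proof. by case: sK. Qed.

Lemma subringB a b : K a -> K b -> K (a - b).
Proof. by case: sK => _ h Ka /(h a _ Ka)[]. Qed.

Lemma subringM a b : K a -> K b -> K (a * b).
Proof. by case: sK => _ h Ka /(h a _ Ka)[]. Qed.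

Lemma subring0 : K 0.
Proof. by rewrite -(subrr 1); apply: subringB; apply: subring1. Qed.

Lemma subringN a : K a -> K (- a).
Proof. by rewrite -sub0r; apply: subringB; apply: subring0. Qed.

Lemma subringD a b : K a -> K b -> K (a + b).
Proof. by move=> Ka Kb; rewrite -[b]opprK; apply/subringB/subringN. Qed.

Lemma subringX a m : K a -> K (a ^+ m).
Proof.
move=> Ka; elim: m => [|m IHm]; first exact: subring1.
by rewrite exprS; apply: subringM.
Qed.

Lemma subring_sum (I : eqType) (r : seq I) (P : pred I) (E : I -> S) :
  (forall i, i \in r -> P i -> K (E i)) -> K (\sum_(i <- r | P i) E i).
Proof.
move=> KE; rewrite big_seq_cond; elim/big_ind: _ => [||i /andP[]].
- exact: subring0.
- exact: subringD.
- exact: KE.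
Qed.

Lemma subring_prod (I : Type) (r : seq I) (P : pred I) (E : I -> S) :
  (forall i, P i -> K (E i)) -> K (\prod_(i <- r | P i) E i).
Proof.
move=> KE; elim/big_ind: _ => [||i].
- exact: subring1.
- exact: subringM.
- exact: KE.
Qed.

Lemma subring_int (z : int) : K z%:~R.
Proof.
have Kn m : K m%:R.
  elim: m => [|m IHm]; first exact: subring0.
  by rewrite -addn1 natrD; apply/subringD/subring1.
by case: z => m; [apply: Kn | rewrite NegzE rmorphN; apply/subringN/Kn].
Qed.

Lemma subring_ev n (v : 'I_n -> S) p : (forall i, K (v i)) -> K (ev v p).
Proof.
move=> Kv; elim/mpoly_gen_ind: p => [c|i|p q Kp Kq|p q Kp Kq].
- by rewrite evC; apply: subring_int.
- by rewrite evX.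
- by rewrite rmorphD; apply: subringD.
- by rewrite rmorphM; apply: subringM.
Qed.

Lemma subring_meval n (x : 'I_n -> S) (p : {mpoly S[n]}) :
  (forall m, K p@_m) -> (forall i, K (x i)) -> K p.@[x].
Proof.
move=> Kp Kx; rewrite mevalE; apply: subring_sum => m _ _.
by apply/subringM => //; apply: subring_prod => i _; apply: subringX.
Qed.

Lemma subring_horner (p : {poly S}) z :
  (forall i, K p`_i) -> K z -> K p.[z].
Proof.
move=> Kp Kz; rewrite horner_coef; apply: subring_sum => i _ _.
by apply: subringM => //; apply: subringX.
Qed.

End SubringPred.

Lemma subring_poly (S : comRingType) (K : S -> Prop) : subring_pred K ->
  @subring_pred {poly S} (fun p => forall i, K p`_i).
Proof.
move=> sK; split=> [i|p q Kp Kq].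
  by rewrite coef1; case: eqP => _; [apply: subring1 | apply: subring0].
split=> i; first by rewrite coefB; apply: subringB.
by rewrite coefM; apply: subring_sum => // j _ _; apply: subringM.
Qed.

Lemma subring_mpoly n (S : comRingType) (K : S -> Prop) : subring_pred K ->
  @subring_pred {mpoly S[n]} (fun p => forall m, K p@_m).
Proof.
move=> sK; split=> [m|p q Kp Kq].
  by rewrite mcoeff1; case: eqP => _; [apply: subring1 | apply: subring0].
split=> m; first by rewrite mcoeffB; apply: subringB.
by rewrite mcoeffM; apply: subring_sum => // j _ _; apply: subringM.
Qed.

Definition image_ev n (S : comRingType) (v : 'I_n -> S) (y : S) : Prop :=
  exists p, y = ev v p.

Lemma image_ev_subring n (S : comRingType) (v : 'I_n -> S) :
  subring_pred (image_ev v).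
Proof.
split=> [|_ _ [p ->] [q ->]]; first by exists 1; rewrite rmorph1.
by split; [exists (p - q); rewrite rmorphB | exists (p * q); rewrite rmorphM].
Qed.

Section PolyLaurent.
Variables (F : fieldType) (K : F -> Prop) (n : nat) (x : 'I_n -> F).
Hypothesis sK : is_subring K.

Lemma is_int_subring : is_subring (@is_int F).
Proof.
split=> [|_ _ [a ->] [b ->]]; first by exists 1.
by split; [exists (a - b); rewrite rmorphB | exists (a * b); rewrite rmorphM].
Qed.

Lemma mcoeff_varP i m : K (('X_i : {mpoly F[n]})@_m).
Proof.
by rewrite mcoeffX; case: eqP => _; [apply: subring1 | apply: subring0].
Qed.

Lemma mcoeff_constP c m : K c -> K ((c%:MP : {mpoly F[n]})@_m).
Proof.
by move=> Kc; rewrite mcoeffC; case: eqP => _; rewrite ?mulr1 ?mulr0 //;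
   apply: subring0.
Qed.

Lemma poly_ring_subring : is_subring (poly_ring K x).
Proof.
have sP := subring_mpoly n sK.
split; first by exists 1; split; [case: sP | rewrite meval1].
move=> _ _ [p [Kp ->]] [q [Kq ->]]; split.
  by exists (p - q); rewrite mevalB; split=> //; apply: (subringB sP).
by exists (p * q); rewrite mevalM; split=> //; apply: (subringM sP).
Qed.

Lemma poly_ring_var i : poly_ring K x (x i).
Proof. by exists 'X_i; rewrite mevalXU; split=> // m; apply: mcoeff_varP. Qed.

Hypothesis x0 : forall i, x i != 0.

Lemma monom_neq0 (m : 'X_{1..n}) : \prod_(i < n) x i ^+ m i != 0.
Proof. by apply/prodf_neq0 => i _; rewrite expf_neq0. Qed.

Lemma laurent_subring : is_subring (laurent_ring K x).
Proof.
have sP := subring_mpoly n sK.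
have KX m : forall m', K ('X_[m] : {mpoly F[n]})@_m'.
  by move=> m'; rewrite mcoeffX; case: eqP => _;
     [apply: subring1 | apply: subring0].
have xD m1 m2 : \prod_(i < n) x i ^+ (m1 + m2)%MM i =
    (\prod_(i < n) x i ^+ m1 i) * \prod_(i < n) x i ^+ m2 i.
  by rewrite -big_split; apply: eq_bigr => i _; rewrite mnmDE exprD.
split.
  exists 1, 0%MM; split; first by case: sP.
  by rewrite meval1 big1 ?divr1 // => i _; rewrite mnm0E expr0.
move=> _ _ [p [m1 [Kp ->]]] [q [m2 [Kq ->]]]; split.
  exists (p * 'X_[m2] - q * 'X_[m1]), (m1 + m2)%MM; split.
    by apply: (subringB sP); apply: (subringM sP).
  rewrite mevalB !mevalM !mevalX xD; field.
  by rewrite !monom_neq0.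
exists (p * q), (m1 + m2)%MM; split; first exact: (subringM sP).
by rewrite mevalM xD; field; rewrite !monom_neq0.
Qed.

Lemma laurent_monom c (m : 'X_{1..n}) :
  K c -> laurent_ring K x (c / \prod_(i < n) x i ^+ m i).
Proof.
move=> Kc; exists c%:MP, m; rewrite mevalC; split=> // m'.
exact: mcoeff_constP.
Qed.

Lemma laurent_const c : K c -> laurent_ring K x c.
Proof.
move=> Kc; have := laurent_monom 0%MM Kc.
by rewrite big1 ?divr1 // => i _; rewrite mnm0E expr0.
Qed.

Lemma laurent_var i : laurent_ring K x (x i).
Proof.
exists 'X_i, 0%MM; rewrite mevalXU; split; first exact: mcoeff_varP.
by rewrite big1 ?divr1 // => j _; rewrite mnm0E expr0.
Qed.

Lemma laurent_varV i : laurent_ring K x (x i)^-1.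
Proof.
have := laurent_monom U_(i) (subring1 sK).
rewrite (bigD1 i) //= mnm1E eqxx expr1 big1 ?mulr1 ?div1r // => j ji.
by rewrite mnm1E eq_sym (negbTE ji) expr0.
Qed.

Lemma laurent_clear (T : F -> Prop) y : subring_pred T ->
    (forall c, K c -> T c) -> (forall i, T (x i)) -> laurent_ring K x y ->
  exists m, T (y * (\prod_(i < n) x i) ^+ m).
Proof.
move=> sT KT Tx [p [m [Kp ->]]].
pose D := (\sum_(i < n) m i)%N; exists D.
have -> : p.@[x] / (\prod_(i < n) x i ^+ m i) * (\prod_(i < n) x i) ^+ D =
    p.@[x] * \prod_(i < n) x i ^+ (D - m i).
  rewrite -mulrA; congr (_ * _); apply: (mulfI (monom_neq0 m)).
  rewrite mulVKf ?monom_neq0 // -prodrXl -big_split; apply: eq_bigr => i _ /=.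
  by rewrite -exprD subnKC // /D (bigD1 i) //= leq_addr.
apply: (subringM sT); first by apply: subring_meval => // m'; apply: KT.
by apply: subring_prod => // i _; apply: subringX.
Qed.
End PolyLaurent.

(** One common denominator serves all coefficients of a Laurent polynomial, so
   localizing the ground ring localizes the Laurent ring. *)
Lemma laurent_localization (F : fieldType) (A Ah I : F -> Prop) n
    (x : 'I_n -> F) :
    is_subring A -> is_subring Ah -> is_subring I -> is_localization A Ah ->
    (forall y, A y -> I y) -> (forall i, I (x i)) -> (forall i, x i != 0) ->
  is_localization I (laurent_ring Ah x).
Proof.
move=> sA sAh sI loc AI Ix x0 _ [p [m [Ahp ->]]].
have [s [As s0 Ahs sp]] : exists s, [/\ A s, s != 0, Ah s^-1
    & forall m', m' \in msupp p -> A (s * p@_m')].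
  elim: (msupp p) => [|m' r [s [As s0 Ahs sr]]].
    by exists 1; rewrite invr1; split; [case: sA|apply: oner_neq0|case: sAh|].
  have [a [t [Aa At t0 Aht pE]]] := loc _ (Ahp m').
  exists (s * t); split.
  - exact: subringM.
  - by rewrite mulf_neq0.
  - by rewrite invfM; apply: (subringM sAh).
  move=> m''; rewrite inE => /orP[/eqP->|/sr Asp].
    by rewrite pE; have -> : s * t * (a / t) = s * a by [field]; apply: subringM.
  by rewrite mulrAC; apply: subringM.
exists (s * p.@[x]), (s * \prod_(i < n) x i ^+ m i); split.
- rewrite mevalE mulr_sumr; apply: (subring_sum sI) => m' /sp Asp _.
  rewrite mulrA; apply: (subringM sI); first exact: AI.
  by apply: (subring_prod sI) => i _; apply: (subringX sI).
- apply: (subringM sI); first exact: AI.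
  by apply: (subring_prod sI) => i _; apply: (subringX sI).
- by rewrite mulf_neq0 // monom_neq0.
- by rewrite invfM; apply: laurent_monom.
- by field; rewrite s0 monom_neq0.
Qed.

(** * Regular elements *)

Section Regular.
Variables (F : fieldType) (T : F -> Prop).
Hypothesis sT : subring_pred T.
Implicit Types (q w h u y : F).

(** [w] is a non-zero-divisor modulo [q] in [T]; that [q] divides [h] in [T] is
   written as [T (h / q)]. *)
Definition regular q w : Prop :=
  forall h, T h -> T (w * h / q) -> T (h / q).

Lemma regularM q w1 w2 :
  T w2 -> regular q w1 -> regular q w2 -> regular q (w1 * w2).
Proof.
move=> Tw2 r1 r2 h Th Twh; apply: r2 => //; apply: r1; first exact: subringM.
by rewrite mulrA.
Qed.

Lemma regularX q w m : T w -> regular q w -> regular q (w ^+ m).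
Proof.
move=> Tw rw; elim: m => [|m IHm]; first by move=> h _; rewrite expr0 mul1r.
by rewrite exprS; apply: regularM => //; apply: subringX.
Qed.

Lemma regular_unit q w : w != 0 -> T w^-1 -> regular q w.
Proof.
move=> w0 Tw h Th Twh; rewrite -[h](mulKf w0) -mulrA.
exact: (subringM sT).
Qed.

Lemma regular_cancel q u w : T u -> regular q (u * w) -> regular q w.
Proof.
move=> Tu ruw h Th Twh; apply: ruw => //.
by rewrite -!mulrA mulrA -mulrA; apply: subringM => //; rewrite mulrA.
Qed.

Lemma regular_congr q w w' t :
  q != 0 -> T t -> w = w' + q * t -> regular q w' -> regular q w.
Proof.
move=> q0 Tt -> rw' h Th; have -> : (w' + q * t) * h / q = w' * h / q + t * h.
  by field.
move=> Twh; apply: rw' => //; rewrite -(addrK (t * h) (w' * h / q)).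
by apply: (subringB sT) => //; apply: (subringM sT).
Qed.

(** Two denominators of [y] that have nothing in common: the powers of [q] can be
   removed one by one, since [w ^+ b] is regular modulo [q]. *)
Lemma regular_denominators q w a b y : q != 0 -> T q -> T w -> regular q w ->
  T (y * q ^+ a) -> T (y * w ^+ b) -> T y.
Proof.
move=> q0 Tq Tw rw; elim: a => [|a IHa]; first by rewrite expr0 mulr1.
move=> Tyq Tyw; apply: IHa => //.
have -> : y * q ^+ a = y * q ^+ a.+1 / q by rewrite exprSr mulrA mulfK.
apply: (@regularX q w b Tw rw) => //.
have -> : w ^+ b * (y * q ^+ a.+1) / q = y * w ^+ b * q ^+ a.
  by rewrite exprSr; field.
by apply: subringM => //; apply: subringX.
Qed.
End Regular.

(** Clear the denominators of [h] and of [w * h / q], and divide in the polynomial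
   ring. *)
Lemma regular_ev n (F : fieldType) (T : F -> Prop) (v : 'I_n -> F)
    (q w : {mpoly int[n]}) :
    subring_pred T -> (forall y, image_ev v y -> T y) ->
    is_localization (image_ev v) T -> injective (ev v) -> q != 0 ->
    (forall h, divides q (w * h) -> divides q h) ->
  regular T (ev v q) (ev v w).
Proof.
move=> sT IT loc inj q0 rw h Th Twh.
have vq0 : ev v q != 0 by rewrite -(rmorph0 (ev v)) (inj_eq inj).
have [_ [_ [[a ->] [s ->] s0 Ts hE]]] := loc _ Th.
have [_ [_ [[b ->] [t ->] t0 Tt gE]]] := loc _ Twh.
have [c cE] : divides q (a * t).
  apply: rw; exists (b * s); apply: inj; rewrite !rmorphM /=.
  move: gE; rewrite hE => gE.
  have -> : ev v b = ev v w * (ev v a / ev v s) / ev v q * ev v t.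
    by rewrite gE mulfVK.
  by field; rewrite vq0 s0.
have -> : h / ev v q = ev v c * (ev v s)^-1 * (ev v t)^-1.
  have e : ev v a * ev v t = ev v c * ev v q by rewrite -!rmorphM cE.
  have -> : ev v c = ev v a * ev v t / ev v q by rewrite e mulfK.
  by rewrite hE; field; rewrite vq0 s0 t0.
by apply: (subringM sT) => //; apply: (subringM sT) => //; apply: IT; exists c.
Qed.

(** * Separating one variable *)

Section OneVariable.
Variables (n : nat) (l : 'I_n).
Local Notation P := {mpoly int[n]}.
Implicit Types (f g h p q : P).

Definition kill : P -> P := ev (fun j => if j == l then 0 else 'X_j).

HB.instance Definition _ :=
  GRing.RMorphism.copy kill (ev (fun j => if j == l then (0 : P) else 'X_j)).

Definition free_of p : Prop := kill p = p.

Lemma dvd_kill p : divides 'X_l (p - kill p).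
Proof.
elim/mpoly_gen_ind: p => [c|i|p q dp dq|p q dp dq].
- rewrite /kill evC -[c in c%:MP]intz raddfMz subrr; exact: dvd0.
- rewrite /kill evX; case: eqP => [->|_]; last by rewrite subrr; apply: dvd0.
  by rewrite subr0; apply: dvdxx.
- have -> : p + q - kill (p + q) = (p - kill p) + (q - kill q).
    by rewrite rmorphD /=; move: (kill p) (kill q) => a b; ring.
  exact (dvdD dp dq).
- have -> : p * q - kill (p * q) = (p - kill p) * q + kill p * (q - kill q).
    by rewrite (rmorphM kill) mulrBl mulrBr addrA subrK.
  exact (dvdD (dvd_mulr q dp) (dvd_mull (kill p) dq)).
Qed.

Lemma kill_var : kill 'X_l = 0.
Proof. by rewrite /kill evX eqxx. Qed.

Lemma mpolyX_neq0 : ('X_l : P) != 0.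
Proof.
apply/eqP => /(congr1 (fun p : P => p@_U_(l))).
by rewrite mcoeffX eqxx mcoeff0.
Qed.

(** Setting the variable to zero in the product kills the cofactor of [q], and
   what it kills is divisible by the variable, which cancels. *)
Lemma dvd_mul_var q h : kill q != 0 -> divides q ('X_l * h) -> divides q h.
Proof.
move=> kq [c cE].
have kc : kill c = 0.
  have := congr1 kill cE; rewrite !rmorphM /= kill_var mul0r => /eqP.
  by rewrite eq_sym mulf_eq0 (negbTE kq) orbF => /eqP.
have [c'] := dvd_kill c; rewrite kc subr0 => c'E; exists c'.
by apply: (mulfI mpolyX_neq0); rewrite cE c'E; ring.
Qed.

(** Coefficients with respect to the variable [l]. They are kept in [P], which
   avoids renumbering the other variables; [free_in_var_coef] records that [l]
   does not occur in them. *)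
Definition in_var : P -> {poly P} :=
  ev (fun j => if j == l then 'X else ('X_j)%:P).

HB.instance Definition _ := GRing.RMorphism.copy in_var
  (ev (fun j => if j == l then 'X else ('X_j)%:P) : P -> {poly P}).

Lemma in_varK p : (in_var p).['X_l] = p.
Proof.
rewrite -[LHS]/(horner_eval 'X_l (in_var p)) morph_ev -[RHS]ev_id.
apply: eq_ev => j /=; rewrite /horner_eval; case: eqP => [->|_].
  by rewrite hornerX.
by rewrite hornerC.
Qed.

Lemma in_var_free p : free_of p -> in_var p = p%:P.
Proof.
move=> fp; rewrite -{1}fp /kill (morph_ev in_var) -{2}fp /kill.
rewrite (morph_ev polyC); apply: eq_ev => j /=; case: eqP => // jl.
  by rewrite rmorph0.
by rewrite /in_var evX; case: eqP.
Qed.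

Lemma free_in_var_coef p i : free_of (in_var p)`_i.
Proof.
have sF : subring_pred free_of.
  split=> [|a b fa fb]; [|split]; rewrite /free_of ?rmorph1 ?rmorphB ?rmorphM //;
    by rewrite /= fa fb.
move: i; rewrite /in_var; apply: (subring_ev (subring_poly sF)) => j i.
case: eqP => [_|jl].
  by rewrite coefX; case: eqP => _; [apply: (subring1 sF)|apply: (subring0 sF)].
rewrite coefC; case: eqP => _; last exact: (subring0 sF).
by rewrite /free_of /kill evX; case: eqP.
Qed.

(** Compare coefficients with respect to [l], the highest first: when [q] divides
   all higher coefficients of [h], it divides [a] times the next one. *)
Lemma dvd_mul_affine q a b h : free_of q -> free_of a -> free_of b ->
    (forall g, divides q (a * g) -> divides q g) ->
  divides q ((a * 'X_l + b) * h) -> divides q h.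
Proof.
move=> fq fa fb ra [g gE].
have coefE i : a * (in_var h)`_i + b * (in_var h)`_i.+1 = (in_var g)`_i.+1 * q.
  have e : (a%:P * 'X + b%:P) * in_var h = in_var g * q%:P.
    rewrite -(in_var_free fa) -(in_var_free fb) -(in_var_free fq).
    have <- : in_var 'X_l = 'X by rewrite /in_var evX eqxx.
    by rewrite -!(rmorphM in_var) -(rmorphD in_var) -(rmorphM in_var) gE.
  have := congr1 (fun p : {poly P} => p`_i.+1) e.
  by rewrite coefMC mulrDl coefD -mulrA !coefCM coefXM.
have top j : (size (in_var h) <= j)%N -> divides q (in_var h)`_j.
  by move=> sj; rewrite nth_default //; apply: dvd0.
have all k j : (size (in_var h) <= j + k)%N -> divides q (in_var h)`_j.
  elim: k j => [|k IHk] j; first by rewrite addn0; apply: top.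
  rewrite addnS -addSn => /IHk dj; apply: ra.
  have -> : a * (in_var h)`_j = (in_var g)`_j.+1 * q - b * (in_var h)`_j.+1.
    by rewrite -coefE addrK.
  by apply: dvdB; [apply/dvd_mull/dvdxx | apply: dvd_mull].
rewrite -(in_varK h) horner_coef; elim/big_ind: _ => [||i _].
- exact: dvd0.
- exact: dvdD.
- by apply/dvd_mulr/(all (size (in_var h)))/leq_addl.
Qed.
End OneVariable.

Lemma dvd_mul_monom n (q h : {mpoly int[n]}) (m : 'X_{1..n}) :
  (forall j, kill j q != 0) -> divides q ('X_[m] * h) -> divides q h.
Proof.
move=> kq; rewrite mpolyXE_id.
elim: (index_enum _) h => [|i r IHr] h; first by rewrite big_nil mul1r.
rewrite big_cons -mulrA => dq; apply: IHr; move: dq.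
elim: (m i) => [|k IHk]; first by rewrite expr0 mul1r.
by rewrite exprS -mulrA => /dvd_mul_var dq; apply/IHk/dq.
Qed.

(** * Exponents of exchange polynomials *)

Section Arithmetic.
Implicit Types (a b c : int) (d r : nat).

(** The correction term of matrix mutation. *)
Definition mut_corr a b : int := ((`|a| * b + a * `|b|) %/ 2)%Z.

Lemma mut_corr0 b : mut_corr 0 b = 0.
Proof. by rewrite /mut_corr normr0 !mul0r addr0 div0z. Qed.

Definition negpart b : nat := if 0 < b then 0%N else `|b|%N.

(** The positive part of [b] if [a] is positive, its negative part otherwise: by
   [mut_corrE], what [a] multiplies in the correction term. *)
Definition sign_part a b : nat := if 0 < a then negpart (- b) else negpart b.

Lemma mut_corr_num a b : a != 0 ->
  `|a| * b + a * `|b| = (a * sign_part a b) * 2.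
Proof.
move=> a0; rewrite /sign_part /negpart oppr_gt0 abszN.
by case: (ltrgtP a 0) a0 => // a0 _; case: (ltrgtP b 0) => [b0|b0|->];
  rewrite ?normr0 ?(gtr0_norm a0) ?(ltr0_norm a0) ?(gtr0_norm b0)
    ?(ltr0_norm b0); lia.
Qed.

Lemma mut_corrE a b : a != 0 -> mut_corr a b = a * sign_part a b.
Proof. by move=> a0; rewrite /mut_corr mut_corr_num // mulzK. Qed.

Lemma mut_corr2 a b : mut_corr a b * 2 = `|a| * b + a * `|b|.
Proof.
have [->|a0] := eqVneq a 0; first by rewrite mut_corr0 normr0 !mul0r addr0.
by rewrite mut_corr_num // mut_corrE.
Qed.

Lemma mut_corrN a b : mut_corr (- a) (- b) = - mut_corr a b.
Proof.
have [->|a0] := eqVneq a 0; first by rewrite oppr0 !mut_corr0.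
rewrite !mut_corrE ?oppr_eq0 // mulNr; congr (- (_ * _)).
by rewrite /sign_part oppr_gt0 opprK; case: (ltrgtP a 0) a0.
Qed.

(** The exponent with which a variable occurs in the [r]-th term of an exchange
   polynomial, [b] being the corresponding entry of the exchange matrix. *)
Definition term_exp d r b : nat :=
  (((if (0 < b)%R then r else d - r) * `|b|) %/ d)%N.

Lemma term_expE d r b : (0 < d)%N -> (r <= d)%N ->
  (term_exp d r b : int) = ((r%:Z * b) %/ d%:Z)%Z + negpart b.
Proof.
move=> d0 rd; rewrite /term_exp /negpart -divz_nat; case: ltP => b0.
  by rewrite addr0 PoszM abszE gtr0_norm.
have -> : ((d - r) * `|b|)%N = `|b|%N%:Z * d%:Z + r%:Z * b :> int.
  by rewrite PoszM abszE ler0_norm // -subzn //; ring.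
by rewrite divzMDl ?gt_eqF // addrC.
Qed.

(** As [d] divides [b], no rounding occurs, and the two exponents are the shares
   [r] and [d - r] of the absolute value of [b]. *)
Lemma term_expN d r b : (0 < d)%N -> (r <= d)%N -> (d %| `|b|)%N ->
  (term_exp d r b + term_exp d r (- b))%N = `|b|%N.
Proof.
move=> d0 rd /dvdnP[c bE]; rewrite /term_exp oppr_gt0 abszN bE !mulnA !mulnK //.
by case: (ltrgtP b 0) => [b0|b0|b0]; move: bE; rewrite ?b0 /=; nia.
Qed.

(** The exponent of the variable [j] in the monomial by which the exchange
   polynomials in direction [l] of two seeds adjacent in direction [k] differ
   after the substitution of [ev_exch_subst]; [a], [b] and [c] are the entries
   (l, k), (l, j) and (k, j). The truncated difference is nonnegative as an
   integer, because negative parts are subadditive. *)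
Definition mut_excess a b c : nat :=
  (negpart (b + mut_corr a c)%R + negpart (- a)%R * sign_part a c
   - negpart b)%N.

(** The difference of the two exponents does not depend on [r]: mutation changes
   [b] by a multiple of [a], and [r * a] is divisible by [d], so the change
   passes through the floor. *)
Lemma term_exp_mut d r a b c :
    (0 < d)%N -> (r <= d)%N -> a != 0 -> (d %| `|a|)%N ->
  (term_exp d r (b + mut_corr a c) + sign_part a c * term_exp d r (- a))%N =
  (mut_excess a b c + term_exp d r b)%N.
Proof.
move=> d0 rd a0 da; apply/eqP; rewrite -eqz_nat; apply/eqP.
rewrite !PoszD PoszM !term_expE // /mut_excess.
have [e aE] : exists e, a = e * d%:Z by apply/dvdzP; rewrite dvdzE.
have dz : d%:Z != 0 by rewrite gt_eqF.
rewrite mut_corrE //; move: (sign_part a c) => t.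
have -> : r%:Z * (b + a * t) = (r%:Z * e * t) * d%:Z + r%:Z * b.
  by rewrite aE; ring.
have -> : r%:Z * - a = (- (r%:Z * e)) * d%:Z by rewrite aE; ring.
rewrite divzMDl // mulzK //; move: (_ %/ _)%Z => w.
have le : (negpart b <= negpart (b + a * t)%R + negpart (- a)%R * t)%N.
  by rewrite /negpart; do 3 case: ltP => ?; nia.
by rewrite -subzn // !PoszD !PoszM; ring.
Qed.
End Arithmetic.

(** * Exchange polynomials *)

Section ExchangePolynomials.
Variables (N M : nat) (d : 'I_N -> nat).
Implicit Types (S : seed M d) (k l : 'I_N).
Local Notation cl i := (lshift M i).

Lemma skew_principal S : skew_symmetrizable (lsubmx (exmat S)) ->
  exists D : 'I_N -> int, (forall i, 0 < D i) /\
    forall i j, D i * exmat S i (cl j) = - (D j * exmat S j (cl i)).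
Proof.
case=> D [D0 DB]; exists (D 0); split=> // i j.
by move: DB; rewrite mul_diag_mx => /matrixP/(_ j i); rewrite !mxE.
Qed.

(** The properties of initial data, with the transcendence basis reduced to
   algebraic independence over the integers. *)
Definition seed_inv S : Prop :=
  [/\ injective (ev (ext_cluster S)),
      exists D : 'I_N -> int, (forall i, 0 < D i) /\
        forall i j, D i * exmat S i (cl j) = - (D j * exmat S j (cl i)),
      forall i, (0 < d i)%N /\ forall j, (d i %| `|exmat S i (cl j)|)%N
    & forall i, strings S (@ord0 (d i)) = 0%MM
             /\ strings S (@ord_max (d i)) = 0%MM].

Lemma exmat_diag S k : seed_inv S -> exmat S k (cl k) = 0.
Proof.
case=> _ [D [D0 DB]] _ _; have := DB k k; have := D0 k.
move: (D k) (exmat S k _) => a b a0 /eqP; rewrite -addr_eq0 -mulr2n mulrn_eq0 /=.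
by rewrite mulf_eq0 gt_eqF //= => /eqP.
Qed.

Lemma exmat_sign S k l : seed_inv S ->
  (0 < exmat S l (cl k)) = (exmat S k (cl l) < 0).
Proof.
case=> _ [D [D0 DB]] _ _; have := DB k l.
rewrite -(pmulr_rlt0 _ (D0 k)) => ->.
by rewrite oppr_lt0 pmulr_rgt0.
Qed.

Lemma exmat_sym0 S k l : seed_inv S ->
  (exmat S l (cl k) == 0) = (exmat S k (cl l) == 0).
Proof.
case=> _ [D [D0 DB]] _ _; have := DB k l.
move=> e; have := mulf_eq0 (D k) (exmat S k (cl l)).
by rewrite e oppr_eq0 mulf_eq0 (gt_eqF (D0 l)) (gt_eqF (D0 k)).
Qed.

Section Term.
Variables (S : seed M d) (k : 'I_N).
Hypothesis inv : seed_inv S.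

Let dk_gt0 : (0 < d k)%N. Proof. by case: inv => _ _ /(_ k)[]. Qed.

(** For a cluster variable the floor is an exact quotient, so cluster and stable
   variables enter the terms in the same way. *)
Lemma exch_polyE : exch_poly S k =
  \sum_(r < (d k).+1) string_mon S r *
     \prod_(j < N + M) 'X_j ^+ term_exp (d k) r (exmat S k j).
Proof.
have dv j : (d k %| `|exmat S k (cl j)|)%N by case: inv => _ _ /(_ k)[].
have regroup (R : comRingType) (s a b c e : R) :
  s * a * b * c * e = s * ((a * c) * (b * e)) by ring.
apply: eq_bigr => r _; have rd : (r <= d k)%N by rewrite -ltnS.
rewrite regroup big_split_ord /=; congr (_ * (_ * _)).
  rewrite /u_gt /u_lt -!prodrXl big_mkcond [X in _ * X]big_mkcond -big_split /=.
  apply: eq_bigr => i _; have /dvdnP[c bE] := dv i.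
  rewrite /term_exp -!exprM bE mulnK //.
  case: (ltrgtP (exmat S k (cl i)) 0) => b0.
  - by rewrite mul1r mulnA mulnK // mulnC.
  - by rewrite mulr1 mulnA mulnK // mulnC.
  - move: bE; rewrite b0 => /esym/eqP; rewrite muln_eq0 (gtn_eqF dk_gt0) orbF.
    by move=> /eqP->; rewrite mul0n muln0 div0n expr0 mulr1.
rewrite /v_gt /v_lt big_mkcond [X in _ * X]big_mkcond -big_split /=.
apply: eq_bigr => j _; rewrite /term_exp.
case: (ltrgtP (exmat S k (rshift N j)) 0) => b0; rewrite ?mul1r ?mulr1 //.
by rewrite b0 muln0 div0n expr0.
Qed.

Lemma ev_string_mon (R : comRingType) (w : 'I_(N + M) -> R) (r : 'I_(d k).+1) :
  ev w (string_mon S r) = \prod_(j < M) w (rshift N j) ^+ strings S r j.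
Proof.
rewrite /string_mon rmorph_prod; apply: eq_bigr => j _.
by rewrite rmorphXn /= evX.
Qed.

Lemma ev_exch (R : comRingType) (w : 'I_(N + M) -> R) : ev w (exch_poly S k) =
  \sum_(r < (d k).+1) ev w (string_mon S r) *
     \prod_(j < N + M) w j ^+ term_exp (d k) r (exmat S k j).
Proof.
rewrite exch_polyE rmorph_sum; apply: eq_bigr => r _.
rewrite rmorphM; congr (_ * _); rewrite rmorph_prod; apply: eq_bigr => j _.
by rewrite rmorphXn /= evX.
Qed.

Lemma ev_exch_ext (R : comRingType) (w w' : 'I_(N + M) -> R) i :
    exmat S k (cl i) = 0 -> (forall j, j != cl i -> w j = w' j) ->
  ev w (exch_poly S k) = ev w' (exch_poly S k).
Proof.
move=> b0 ww'; rewrite !ev_exch; apply: eq_bigr => r _; congr (_ * _).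
  by rewrite !ev_string_mon; apply: eq_bigr => j _; rewrite ww' // eq_rlshift.
apply: eq_bigr => j _; have [->|ji] := eqVneq j (cl i); last by rewrite ww'.
by rewrite b0 /term_exp muln0 div0n !expr0.
Qed.

Lemma free_exch i : exmat S k (cl i) = 0 -> free_of (cl i) (exch_poly S k).
Proof.
move=> b0; rewrite /free_of /kill -[RHS]ev_id.
by apply: (ev_exch_ext b0) => j; case: eqP.
Qed.

Lemma term_exp0 (b : int) : term_exp (d k) 0 b = negpart b.
Proof.
by rewrite /term_exp /negpart subn0; case: ltP => _; rewrite ?div0n ?mulKn.
Qed.

Lemma term_exp_max (b : int) : term_exp (d k) (d k) b = negpart (- b).
Proof.
rewrite /term_exp /negpart subnn oppr_gt0 abszN.
by case: (ltrgtP b 0) => b0; rewrite ?div0n ?mulKn ?b0.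
Qed.

Lemma ev_string_mon_end (R : comRingType) (w : 'I_(N + M) -> R)
    (r : 'I_(d k).+1) :
  r = ord0 \/ r = ord_max -> ev w (string_mon S r) = 1.
Proof.
have [_ _ _ /(_ k)[s0 s1]] := inv.
by case=> ->; rewrite ev_string_mon (s0, s1) big1 // => j _; rewrite mnm0E.
Qed.

(** An exchange polynomial has nonnegative coefficients, and each variable is
   absent from its first or from its last term: setting it to zero and all other
   variables to one gives a positive integer. *)
Lemma kill_exch_neq0 j : kill j (exch_poly S k) != 0.
Proof.
apply/eqP => /(congr1 (ev (fun _ => 1 : int))).
pose w i : int := (i != j)%:R.
rewrite rmorph0 /kill ev_ev (@eq_ev _ _ _ w) => [|i]; last first.
  by rewrite /w; case: eqP => _; rewrite ?rmorph0 ?evX.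
have w_ge0 i : 0 <= w i by rewrite ler0n.
have w1 i : i != j -> w i = 1 by rewrite /w => ->.
rewrite ev_exch.
pose r : 'I_(d k).+1 := if 0 < exmat S k j then ord0 else ord_max.
have rE : term_exp (d k) r (exmat S k j) = 0%N.
  rewrite /term_exp /r; case: ltP => _ /=; first by rewrite mul0n div0n.
  by rewrite subnn mul0n div0n.
rewrite (bigD1 r) //= ev_string_mon_end; last first.
  by rewrite /r; case: ltP => _; [left | right].
rewrite mul1r big1 => [|i _]; last first.
  have [->|/w1->] := eqVneq i j; last exact: expr1n.
  by rewrite rE expr0.
apply/eqP; rewrite gt_eqF // ltr_wpDr // sumr_ge0 // => i _.
rewrite mulr_ge0 ?prodr_ge0 // => [|a _]; last by rewrite exprn_ge0.
by rewrite ev_string_mon prodr_ge0 // => a _; rewrite exprn_ge0.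
Qed.

Lemma exch_neq0 : exch_poly S k != 0.
Proof.
by apply: contraNneq (kill_exch_neq0 (cl k)) => ->; rewrite rmorph0.
Qed.

(** A cluster variable that occurs in an exchange polynomial is absent from one
   of its two end terms, and divides all other terms. The integer [a] stands for
   the opposite matrix entry, of which only the sign matters. *)
Lemma ev_exch_at0 (R : comRingType) (w : 'I_(N + M) -> R) l (a : int) :
    exmat S k (cl l) != 0 -> (0 < a) = (exmat S k (cl l) < 0) ->
    w (cl l) = 0 ->
  ev w (exch_poly S k) = \prod_(j < N + M) w j ^+ sign_part a (exmat S k j).
Proof.
have dv : (d k %| `|exmat S k (cl l)|)%N by case: inv => _ _ /(_ k)[].
move=> b0 aE w0; rewrite ev_exch /sign_part aE.
pose r0 : 'I_(d k).+1 := if exmat S k (cl l) < 0 then ord_max else ord0.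
rewrite (bigD1 r0) //= ev_string_mon_end; last first.
  by rewrite /r0; case: ltP => _; [right | left].
rewrite mul1r [X in _ + X]big1 => [|r rr0].
  rewrite addr0; apply: eq_bigr => j _; congr (_ ^+ _).
  by rewrite /r0; case: ltP => _; rewrite ?term_exp0 ?term_exp_max.
rewrite [X in _ * X](bigD1 (cl l)) //= w0 expr0n.
suff /negbTE-> : term_exp (d k) r (exmat S k (cl l)) != 0%N.
  by rewrite mul0r mulr0.
have /dvdnP[c bE] := dv.
have c0 : (0 < c)%N.
  by rewrite lt0n; apply: contra b0 => /eqP c0; rewrite -absz_eq0 bE c0.
rewrite /term_exp bE mulnA mulnK // -lt0n muln_gt0 c0 andbT.
have := ltn_ord r; rewrite ltnS leq_eqVlt => rd.
move: rr0; rewrite /r0; case: (ltrgtP _ 0) b0 => // _ _.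
- by rewrite -val_eqE /= subn_gt0 => /negbTE rr; move: rd; rewrite rr.
- by rewrite -val_eqE /= lt0n.
Qed.
End Term.

End ExchangePolynomials.

(** * Mutations *)

Section Mutations.
Variables (N M : nat) (d : 'I_N -> nat).
Implicit Types (S : seed M d) (k l : 'I_N).
Local Notation cl i := (lshift M i).

Lemma ext_cluster_cl S i : ext_cluster S (cl i) = cluster S i.
Proof. by rewrite /ext_cluster (unsplitK (inl i)). Qed.

Lemma ext_cluster_stable S j : ext_cluster S (rshift N j) = stable N j.
Proof. by rewrite /ext_cluster (unsplitK (inr j)). Qed.

Lemma ext_cluster_mutate S k j : ext_cluster (mutate S k) j =
  if j == cl k then ev (ext_cluster S) (exch_poly S k) / cluster S k
  else ext_cluster S j.
Proof.
case: (split_ordP j) => i ->.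
  by rewrite !ext_cluster_cl /= /mut_cluster (inj_eq (@lshift_inj _ _)) evE.
by rewrite !ext_cluster_stable eq_rlshift.
Qed.

Lemma exmat_mutate S k i j : exmat (mutate S k) i j =
  if (i == k) || (j == cl k) then - exmat S i j
  else exmat S i j + mut_corr (exmat S i (cl k)) (exmat S k j).
Proof. by rewrite mxE. Qed.

Lemma exmat_mutate_row S k j : exmat (mutate S k) k j = - exmat S k j.
Proof. by rewrite exmat_mutate eqxx. Qed.

Lemma exmat_mutate_neq S k l j : k != l -> exmat (mutate S k) l j =
  if j == cl k then - exmat S l j
  else exmat S l j + mut_corr (exmat S l (cl k)) (exmat S k j).
Proof. by rewrite exmat_mutate eq_sym => /negbTE->. Qed.

Lemma string_mon_mutate_neq S k l (r : 'I_(d l).+1) : k != l ->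
  string_mon (mutate S k) r = string_mon S r.
Proof. by rewrite /string_mon /= /mut_strings eq_sym => /negbTE->. Qed.

Lemma ext_cluster_neq0 S j : seed_inv S -> ext_cluster S j != 0.
Proof.
case=> inj _ _ _; rewrite -(evX (ext_cluster S)) -(rmorph0 (ev (ext_cluster S))).
by rewrite (inj_eq inj) mpolyX_neq0.
Qed.

Lemma cluster_neq0 S i : seed_inv S -> cluster S i != 0.
Proof. by rewrite -ext_cluster_cl; apply: ext_cluster_neq0. Qed.

(** Replacing a variable by [q / x] with [q] free of [x] preserves algebraic
   independence: clear the denominators of a relation and read off its
   coefficients. *)
Lemma injective_exchange n (F : fieldType) (v w : 'I_n -> F) (l : 'I_n) q :
    injective (ev v) -> free_of l q -> q != 0 ->
    (forall j, w j = if j == l then ev v q / v l else v j) ->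
  injective (ev w).
Proof.
move=> inj fq q0 wE; apply: raddf_inj => f f0.
have vl0 : v l != 0.
  rewrite -(evX v) -(rmorph0 (ev v)) (inj_eq inj); exact: mpolyX_neq0.
have vw p : free_of l p -> ev w p = ev v p.
  move=> <-; rewrite /kill !ev_ev; apply: eq_ev => j.
  by case: eqP => [_|/eqP jl]; rewrite ?rmorph0 // !evX wE (negbTE jl).
set g := in_var l f; pose D := size g.
(* the relation, multiplied by v l ^+ D, is the value of a polynomial at v *)
have h0 : \sum_(i < D) g`_i * q ^+ i * 'X_l ^+ (D - i) = 0.
  apply: inj; rewrite rmorph0 rmorph_sum /=.
  transitivity (v l ^+ D * ev w f); last by rewrite f0 mulr0.
  rewrite -[in RHS](in_varK l f) horner_coef rmorph_sum mulr_sumr.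
  apply: eq_bigr => i _; rewrite !rmorphM !rmorphXn /= vw; last first.
    exact: free_in_var_coef.
  rewrite !evX wE eqxx expr_div_n -/g.
  rewrite -[in RHS](subnK (ltnW (ltn_ord i))) exprD.
  move: (expf_neq0 i vl0); move: (ev v g`_i) (ev v q ^+ i) (_ ^+ (D - i)) => a b c.
  by move: (v l ^+ i) => e e0; field.
have g0 : g = 0.
  apply/polyP => i; rewrite coef0; have [iD|iD] := ltnP i D; last first.
    by rewrite nth_default.
  have termE (j : nat) : (in_var l (g`_j * q ^+ j * 'X_l ^+ (D - j)))`_(D - i) =
      g`_j * q ^+ j * (D - i == D - j)%N%:R.
    have fj : free_of l (g`_j * q ^+ j).
      rewrite /free_of rmorphM rmorphXn /= fq; congr (_ * _).
      exact: free_in_var_coef.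
    rewrite (rmorphM (in_var l) (g`_j * q ^+ j)) (rmorphXn (in_var l)).
    rewrite /= (in_var_free fj).
    by rewrite {1}/in_var evX eqxx coefCM coefXn.
  have := congr1 (fun p : {mpoly int[n]} => (in_var l p)`_(D - i)) h0.
  rewrite rmorph0 coef0 rmorph_sum coef_sum (bigD1 (Ordinal iD)) //= termE eqxx.
  rewrite mulr1 big1 ?addr0 => [/eqP|j ji].
    by rewrite mulf_eq0 expf_eq0 (negbTE q0) andbF orbF => /eqP.
  rewrite termE; case: eqP => [e|_]; last by rewrite mulr0.
  case/eqP: ji; apply: val_inj => /=; have := ltn_ord j; lia.
by rewrite -(in_varK l f) -/g g0 horner0.
Qed.

(** The matrix condition is checked on twice the correction term, which replaces
   the division by two by the polynomial expression in the entries and their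
   absolute values. *)
Lemma seed_inv_mutate S k : seed_inv S -> seed_inv (mutate S k).
Proof.
move=> inv; have bkk := exmat_diag k inv; case: (inv) => inj [D [D0 DB]] dv st.
split.
- apply: (injective_exchange inj (free_exch inv bkk) (exch_neq0 k inv)) => j.
  by rewrite ext_cluster_mutate ext_cluster_cl.
- exists D; split=> // i j; rewrite !exmat_mutate !eq_lshift.
  rewrite [(j == k) || _]orbC; case: ifP => [_|/norP[ik jk]].
    by rewrite !mulrN DB.
  rewrite !mulrDr DB opprD; congr (_ + _).
  have normE i1 i2 : D i1 * `|exmat S i1 (cl i2)| = D i2 * `|exmat S i2 (cl i1)|.
    have := congr1 Num.norm (DB i1 i2); rewrite normrN !normrM.
    by rewrite (gtr0_norm (D0 i1)) (gtr0_norm (D0 i2)).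
  have two : 2 != 0 :> int by [].
  apply: (mulIf two); rewrite mulNr -!mulrA !mut_corr2 !mulrDr !mulrA.
  by rewrite (normE i k) (normE j k) (DB i k) (DB j k); ring.
- move=> i; have [di dvi] := dv i; split=> // j; rewrite exmat_mutate eq_lshift.
  case: ifP => _; first by rewrite abszN.
  have [e|e] := eqVneq (exmat S i (cl k)) 0; first by rewrite e mut_corr0 addr0.
  rewrite -[d i]/(`|(d i)%:Z|%N) -dvdzE mut_corrE //; apply: rpredD.
    by rewrite dvdzE.
  by apply: dvdz_mulr; rewrite dvdzE.
- move=> i; have [s0 s1] := st i; rewrite /= /mut_strings; case: eqP => _ //.
  have -> : rev_ord (@ord0 (d i)) = ord_max by apply: val_inj; rewrite /= subn1.
  have -> : rev_ord (@ord_max (d i)) = ord0 by apply: val_inj; rewrite /= subnn.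
  by [].
Qed.

Lemma exch_mutate S k : seed_inv S ->
  exch_poly (mutate S k) k = exch_poly S k.
Proof.
move=> inv; have inv' := seed_inv_mutate k inv.
rewrite !exch_polyE //= (reindex_inj rev_ord_inj) /=; apply: eq_bigr => r _.
have rd : (r <= d k)%N by rewrite -ltnS.
congr (_ * _).
  apply: eq_bigr => j _; rewrite /= /mut_strings eqxx; by rewrite rev_ordK.
apply: eq_bigr => j _; rewrite exmat_mutate_row; congr (_ ^+ _).
rewrite /term_exp abszN oppr_gt0 subSS subKn //.
by case: (ltrgtP (exmat S k j) 0) => // ->; rewrite !muln0.
Qed.

Lemma seed_ext S S' : cluster S =1 cluster S' -> exmat S = exmat S' ->
  (forall i, strings S (i := i) =1 strings S' (i := i)) -> S = S'.
Proof.
case: S S' => [c b s] [c' b' s'] /= /functional_extensionality-> -> ss'.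
congr Seed; apply: functional_extensionality_dep => i.
exact/functional_extensionality/ss'.
Qed.

Lemma mutateK S k : seed_inv S -> mutate (mutate S k) k = S.
Proof.
move=> inv; have bkk := exmat_diag k inv; have inv' := seed_inv_mutate k inv.
apply: seed_ext.
- move=> i; rewrite -!ext_cluster_cl ext_cluster_mutate eq_lshift exch_mutate //.
  have [->|ik] := eqVneq i k; last first.
    by rewrite ext_cluster_mutate eq_lshift (negbTE ik).
  rewrite (ev_exch_ext (w' := ext_cluster S) inv bkk) => [|j jk]; last first.
    by rewrite ext_cluster_mutate (negbTE jk).
  rewrite -[cluster (mutate S k) k]ext_cluster_cl ext_cluster_mutate eqxx.
  rewrite ext_cluster_cl invfM invrK mulrA mulfV ?mul1r //.
  have [inj _ _ _] := inv; rewrite -(rmorph0 (ev (ext_cluster S))) (inj_eq inj).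
  exact: exch_neq0.
- apply/matrixP => i j; rewrite exmat_mutate; case: ifP => [c|/norP[ik jk]].
    by rewrite exmat_mutate c opprK.
  rewrite exmat_mutate_row [exmat (mutate S k) i (cl k)]exmat_mutate eqxx orbT.
  by rewrite exmat_mutate (negbTE ik) (negbTE jk) mut_corrN addrK.
- by move=> i r; rewrite /= /mut_strings /= /mut_strings; case: (i == k);
  rewrite ?rev_ordK.
Qed.
End Mutations.

(** * Two adjacent mutations *)

Section Substitution.
Variables (N M : nat) (d : 'I_N -> nat) (F : fieldType).
Variables (S : seed M d) (k l : 'I_N).
Local Notation cl i := (lshift M i).
Local Notation a := (exmat S l (cl k)).
Hypotheses (inv : seed_inv S) (kl : k != l) (a0 : a != 0).

Lemma sign_part_l : sign_part a (exmat S k (cl l)) = 0%N.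
Proof.
have b0 : exmat S k (cl l) != 0 by rewrite -(exmat_sym0 k l inv).
rewrite /sign_part /negpart (exmat_sign k l inv) oppr_gt0.
by case: (ltrgtP (exmat S k (cl l)) 0) b0.
Qed.

Lemma mut_excess_l : mut_excess a (exmat S l (cl l)) (exmat S k (cl l)) = 0%N.
Proof.
rewrite (exmat_diag l inv) /mut_excess mut_corrE // sign_part_l !mulr0 addr0.
by rewrite muln0.
Qed.

(** Substitute for the variable [k] the value at zero of the variable [l] of the
   exchange relation in direction [k]. The substituted expression is a monomial
   divided by the variable [k], and in each term the exponents change by the
   same amounts ([term_exp_mut], and [term_expN] for the variable [k] itself), so
   a monomial factors out. *)
Lemma ev_exch_subst (w w' : 'I_(N + M) -> F) :
    w (cl k) != 0 ->
    (forall j, w' j = if j == cl k then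
        (\prod_(i < N + M) w i ^+ sign_part a (exmat S k i)) / w (cl k)
      else w j) ->
  w (cl k) ^+ `|a|%N * ev w' (exch_poly (mutate S k) l) =
  (\prod_(j | j != cl k) w j ^+ mut_excess a (exmat S l j) (exmat S k j))
    * ev w (exch_poly S l).
Proof.
move=> wk0 w'E; have inv' := seed_inv_mutate k inv.
have [dl0 dv] : (0 < d l)%N /\ forall j, (d l %| `|exmat S l (cl j)|)%N.
  by case: inv => _ _ /(_ l).
rewrite (ev_exch l inv) (ev_exch l inv') !mulr_sumr; apply: eq_bigr => r _.
have rd : (r <= d l)%N by rewrite -ltnS.
rewrite string_mon_mutate_neq //.
have -> : ev w' (string_mon S r) = ev w (string_mon S r).
  by rewrite !ev_string_mon; apply: eq_bigr => j _; rewrite w'E eq_rlshift.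
rewrite (bigD1 (cl k)) //= [in RHS](bigD1 (cl k) (P := xpredT)) //=.
rewrite exmat_mutate_neq // eqxx w'E eqxx.
set e' := term_exp _ _ (- a); set e := term_exp _ _ a.
have e_sum : (e + e')%N = `|a|%N by apply: term_expN.
have main : (\prod_(i < N + M) w i ^+ sign_part a (exmat S k i)) ^+ e' *
    \prod_(j | j != cl k) w' j ^+ term_exp (d l) r (exmat (mutate S k) l j) =
    (\prod_(j | j != cl k) w j ^+ mut_excess a (exmat S l j) (exmat S k j)) *
    \prod_(j | j != cl k) w j ^+ term_exp (d l) r (exmat S l j).
  rewrite (bigD1 (cl k)) //= (exmat_diag k inv).
  have -> : sign_part a 0 = 0%N by rewrite /sign_part oppr0; case: ifP.
  rewrite expr0 mul1r -prodrXl -!big_split; apply: eq_bigr => j jk /=.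
  rewrite w'E (negbTE jk) exmat_mutate_neq // (negbTE jk) -exprM -!exprD.
  by rewrite addnC term_exp_mut.
rewrite -e_sum exprD expr_div_n.
have shuffle (s X Y U W f g : F) : g != 0 -> X * Y = U * W ->
    f * g * (s * (X / g * Y)) = U * (s * (f * W)).
  move=> g0 XY; transitivity (f * s * (X * Y)); first by field.
  by rewrite XY; ring.
by apply: shuffle main; rewrite expf_neq0.
Qed.
End Substitution.

Lemma horner_split (F : fieldType) (K : F -> Prop) (p : {poly F}) z :
    subring_pred K -> (forall i, K p`_i) -> K z ->
  exists2 t, K t & p.[z] = p`_0 + z * t.
Proof.
move=> sK; elim/poly_ind: p => [|p c _] Kp Kz.
  by exists 0; [apply: (subring0 sK) | rewrite horner0 coef0 mulr0 addr0].
exists p.[z]; last first.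
  by rewrite hornerMXaddC coefD coefMX coefC /= add0r mulrC addrC.
apply: (subring_horner sK) => // i; have := Kp i.+1.
by rewrite coefD coefMX coefC addr0.
Qed.

Lemma horner_split2 (F : fieldType) (K : F -> Prop) (p : {poly F}) z :
    subring_pred K -> (forall i, K p`_i) -> K z ->
  exists2 t, K t & p.[z] = p`_0 + z * (p`_1 + z * t).
Proof.
move=> sK; elim/poly_ind: p => [|p c _] Kp Kz.
  exists 0; first exact: (subring0 sK).
  by rewrite horner0 !coef0 mulr0 addr0 mulr0 addr0.
have Kp1 i : K p`_i by have := Kp i.+1; rewrite coefD coefMX coefC addr0.
have [t Kt e] := horner_split sK Kp1 Kz; exists t => //.
by rewrite hornerMXaddC e !coefD !coefMX !coefC /= add0r addr0 mulrC addrC.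
Qed.

Lemma evXm n (S : comRingType) (v : 'I_n -> S) (m : 'X_{1..n}) :
  ev v 'X_[m] = \prod_(i < n) v i ^+ m i.
Proof. by rewrite -evE mmapX. Qed.

(** The extended clusters of a seed and of its neighbour in direction [l] enter
   only through the exchange relation, so their values [v] and [w] may lie in
   any field; [x] and [y] below are the new variables of the seed [S'] adjacent
   in direction [k] and of the seed adjacent to [S'] in direction [l]. *)
Section RankTwo.
Variables (N M : nat) (d : 'I_N -> nat).
Variables (S : seed M d) (k l : 'I_N).
Variables (F : fieldType) (v w : 'I_(N + M) -> F).
Local Notation cl i := (lshift M i).
Local Notation a := (exmat S l (cl k)).
Local Notation b := (exmat S k (cl l)).
Local Notation S' := (mutate S k).
Local Notation P := (exch_poly S k).
Local Notation Q := (exch_poly S l).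
Local Notation Q' := (exch_poly S' l).
Local Notation q := (ev w Q).
Hypotheses (inv : seed_inv S) (kl : k != l).
Hypothesis cop : coprime_elts Q P.
Hypothesis v0 : forall j, v j != 0.
Hypothesis exchange : forall j,
  w j = if j == cl l then ev v Q / v (cl l) else v j.
Hypothesis injw : injective (ev w).

Variable T : F -> Prop.
Hypothesis sT : subring_pred T.
Hypothesis IT : forall y, image_ev w y -> T y.
Hypothesis locT : is_localization (image_ev w) T.
Hypothesis TwV : forall i, T (w (cl i))^-1.

Let x := ev v P / v (cl k).
Let v' j := if j == cl k then x else v j.
Let y := ev v' Q' / v (cl l).

Let Tev p : T (ev w p). Proof. by apply: IT; exists p. Qed.

Let Tw j : T (w j). Proof. by rewrite -(evX w). Qed.

Let wE j : j != cl l -> w j = v j.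
Proof. by rewrite exchange => /negbTE->. Qed.

Let w0 j : w j != 0.
Proof. by rewrite -(evX w) -(rmorph0 (ev w)) (inj_eq injw) mpolyX_neq0. Qed.

Let bll : exmat S l (cl l) = 0. Proof. exact: exmat_diag. Qed.

Let qE : q = ev v Q.
Proof. by apply: (ev_exch_ext inv bll) => j; apply: wE. Qed.

Let q0 : q != 0.
Proof. by rewrite -(rmorph0 (ev w)) (inj_eq injw) exch_neq0. Qed.

Let kl' : cl k != cl l. Proof. by rewrite eq_lshift. Qed.

(** The variable that the mutation in direction [l] replaces is an associate of
   [q] in [T]; congruences modulo [q] are congruences modulo that variable. *)
Let zE : v (cl l) = q * (w (cl l))^-1.
Proof.
by rewrite exchange eqxx -qE invfM invrK mulrA mulfV // mul1r.
Qed.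

Let Tz : T (v (cl l)). Proof. by rewrite zE; apply: subringM. Qed.

Lemma regular_monom m : regular T q (ev w 'X_[m]).
Proof.
apply: (regular_ev sT IT locT injw (exch_neq0 l inv)) => h.
by apply: dvd_mul_monom => j; apply: kill_exch_neq0.
Qed.

(** The exchange polynomial in direction [k], as a polynomial in the variable
   [l]. *)
Let Pz : {poly F} :=
  ev (fun j => if j == cl l then 'X else (w j)%:P) P.

Let Pz_eval c :
  Pz.[c] = ev (fun j => if j == cl l then c else w j) P.
Proof.
rewrite -[LHS]/(horner_eval c Pz) morph_ev; apply: eq_ev => j /=.
by rewrite /horner_eval; case: eqP => _; rewrite ?hornerX ?hornerC.
Qed.

Let Pz_z : Pz.[v (cl l)] = ev v P.
Proof. by rewrite Pz_eval; apply: eq_ev => j; case: eqP => [->|/eqP/wE->]. Qed.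

Let Pz_0 : a != 0 -> Pz.[0] =
  \prod_j (if j == cl l then 0 else w j) ^+ sign_part a (exmat S k j).
Proof.
move=> a0; rewrite Pz_eval; apply: (ev_exch_at0 inv (l := l)).
- by rewrite -(exmat_sym0 k l inv).
- exact: exmat_sign.
- by rewrite eqxx.
Qed.

Let TPz i : T Pz`_i.
Proof.
move: i; apply: (subring_ev (subring_poly sT)) => j i.
case: eqP => _; rewrite ?coefX ?coefC; case: eqP => _ //;
  by [apply: (subring1 sT) | apply: (subring0 sT)].
Qed.

(** The cluster variable replaced by mutation in direction [k], times the
   variable replacing it, is the exchange polynomial [P]: if [P] contains the
   variable [l], it is a monomial modulo that variable, hence modulo [q];
   otherwise it is coprime to [Q]. *)
Lemma regular_exchange1 : T x /\ regular T q x.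
Proof.
have xE : w (cl k) * x = ev v P by rewrite wE // /x mulrC divfK.
have Tx : T (ev v P) by rewrite -Pz_z; apply: subring_horner.
split.
  by rewrite -[x](mulKf (w0 (cl k))) xE; apply: (subringM sT).
apply: (regular_cancel sT (Tw (cl k))); rewrite xE.
have [b0|b0] := eqVneq b 0.
  rewrite (ev_exch_ext (w' := w) inv b0) => [|j jl]; last by rewrite wE.
  apply: (regular_ev sT IT locT injw (exch_neq0 l inv)) => h.
  apply: coprime_dvd.
  - exact: factorial_mpoly_int.
  - exact: exch_neq0.
  - exact: cop.
have a0 : a != 0 by rewrite (exmat_sym0 k l inv).
have [t Tt e] := horner_split sT TPz Tz.
rewrite Pz_z -horner_coef0 zE -mulrA in e.
apply: (regular_congr sT q0 _ e); first exact: subringM.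
rewrite Pz_0 //.
have -> : \prod_j (if j == cl l then 0 else w j) ^+ sign_part a (exmat S k j) =
    ev w 'X_[[multinom sign_part a (exmat S k j) | j < N + M]].
  rewrite evXm; apply: eq_bigr => j _; rewrite mnmE.
  by case: eqP => // ->; rewrite (sign_part_l inv a0) !expr0.
exact: regular_monom.
Qed.

(** The elements that do not involve the new variable and whose only denominators
   are powers of the variable [k]. *)
Let T0 (c : F) : Prop :=
  exists m A, free_of (cl l) A /\ c * w (cl k) ^+ m = ev w A.

Let freeX j m : j != cl l -> free_of (cl l) ('X_j ^+ m).
Proof. by move=> jl; rewrite /free_of rmorphXn /= /kill evX (negbTE jl). Qed.

Let sT0 : subring_pred T0.
Proof.
split; first by exists 0%N, 1; rewrite /free_of !rmorph1 expr0 mulr1.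
have wXk m : w (cl k) ^+ m = ev w ('X_(cl k) ^+ m) by rewrite rmorphXn /= evX.
move=> y1 y2 [m1 [A1 [f1 e1]]] [m2 [A2 [f2 e2]]]; split.
  exists (m1 + m2)%N, (A1 * 'X_(cl k) ^+ m2 - A2 * 'X_(cl k) ^+ m1); split.
    rewrite /free_of rmorphB !(rmorphM (kill (cl l))) /=.
    by rewrite (freeX m1 kl') (freeX m2 kl') f1 f2.
  rewrite rmorphB !(rmorphM (ev w)) /= -e1 -e2 -!wXk exprD; ring.
exists (m1 + m2)%N, (A1 * A2); split.
  by rewrite /free_of (rmorphM (kill (cl l))) /= f1 f2.
by rewrite (rmorphM (ev w)) /= -e1 -e2 exprD; ring.
Qed.

Let T0w j : j != cl l -> T0 (w j).
Proof.
move=> jl; exists 0%N, 'X_j; rewrite expr0 mulr1 evX.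
by split=> //; have := freeX 1 jl; rewrite expr1.
Qed.

Let T0V : T0 (w (cl k))^-1.
Proof. by exists 1%N, 1; rewrite /free_of !rmorph1 expr1 mulVf. Qed.

Let T0T c : T0 c -> T c.
Proof.
case=> m [A [_ e]]; rewrite -[c](mulfK (expf_neq0 m (w0 (cl k)))) e.
by apply: (subringM sT) => //; rewrite -exprVn; apply: subringX.
Qed.

(** The exchange polynomial at [S'] in direction [l] after the substitution of
   the exchange relation in direction [k] for its variable [k], as a polynomial
   in the variable [l]. *)
Let Vz : {poly F} := ev (fun j =>
  if j == cl k then Pz * ((w (cl k))^-1)%:P
  else if j == cl l then 'X else (w j)%:P) (exch_poly S' l).

Let T0Vz i : T0 Vz`_i.
Proof.
have C0 c : T0 c -> forall j, T0 (c%:P`_j).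
  by move=> Kc j; rewrite coefC; case: eqP => _ //; apply: (subring0 sT0).
have X0 j : T0 ('X`_j).
  by rewrite coefX; case: eqP => _; [apply: (subring1 sT0)|apply: (subring0 sT0)].
have sP := subring_poly sT0.
move: i; apply: (subring_ev sP) => j i; case: eqP => [_|_].
  move: i; apply: (subringM sP) => i; last exact: C0.
  move: i; apply: (subring_ev sP) => j' i.
  by case: eqP => [_|/eqP jl]; [apply: X0 | apply/C0/T0w].
by case: eqP => [_|/eqP jl]; [apply: X0 | apply/C0/T0w].
Qed.

Let Vz_eval c : Vz.[c] = ev (fun j =>
  if j == cl k then Pz.[c] / w (cl k) else if j == cl l then c else w j)
  (exch_poly S' l).
Proof.
rewrite -[LHS]/(horner_eval c Vz) morph_ev; apply: eq_ev => j /=.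
rewrite /horner_eval; case: eqP => _; first by rewrite hornerM hornerC.
by case: eqP => _; rewrite ?hornerX ?hornerC.
Qed.

Let Vz_z : Vz.[v (cl l)] = ev v' Q'.
Proof.
rewrite Vz_eval; apply: eq_ev => j; rewrite /v' Pz_z (wE kl').
by case: eqP => // _; case: eqP => [->|/eqP/wE->].
Qed.

Let Vz_0 : a != 0 -> exists m, [/\ free_of (cl l) 'X_[m],
  m (cl k) = 0%N & w (cl k) ^+ `|a|%N * Vz.[0] = ev w 'X_[m] * q].
Proof.
move=> a0; pose m := [multinom
  if j == cl k then 0%N else mut_excess a (exmat S l j) (exmat S k j)
  | j < N + M]; exists m.
have ml : m (cl l) = 0%N.
  by rewrite mnmE eq_sym (negbTE kl') (mut_excess_l inv a0).
split; last 1 first.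
- pose w' j := if j == cl l then 0 else w j.
  rewrite Vz_eval.
  have w'k : w' (cl k) = w (cl k) by rewrite /w' (negbTE kl').
  have w'k0 : w' (cl k) != 0 by rewrite w'k.
  rewrite -w'k (ev_exch_subst inv kl a0 w'k0) => [|j]; last by rewrite Pz_0.
  rewrite (ev_exch_ext (w' := w) inv bll) => [|j jl]; last first.
    by rewrite /w' (negbTE jl).
  congr (_ * _); rewrite evXm [RHS](bigD1 (cl k)) //= mnmE eqxx mul1r.
  apply: eq_bigr => j jk; rewrite mnmE (negbTE jk) /w'.
  by case: eqP => // ->; rewrite (mut_excess_l inv a0) !expr0.
- rewrite /free_of /kill evXm [RHS]mpolyXE_id; apply: eq_bigr => j _.
  by case: eqP => // ->; rewrite ml !expr0.
- by rewrite mnmE eqxx.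
Qed.

(** If the entry (l, k) vanishes, [y] is the new variable [w (cl l)]. Otherwise
   expand [Vz] at zero. Its constant term is a monomial times [q], up to a unit,
   so dividing by [v (cl l)] turns it into a monomial times [w (cl l)]; the
   linear term gives an element free of [w (cl l)], and the rest is divisible by
   [q]. *)
Lemma regular_exchange2 : T y /\ regular T q y.
Proof.
have inv' : seed_inv S' by apply: seed_inv_mutate.
have yE : y = Vz.[v (cl l)] / v (cl l) by rewrite Vz_z.
have [a0|a0] := eqVneq a 0.
  have QQ : Q' = Q.
    rewrite (exch_polyE l inv) (exch_polyE l inv'); apply: eq_bigr => r _.
    rewrite string_mon_mutate_neq //; congr (_ * _); apply: eq_bigr => j _.
    rewrite exmat_mutate_neq // a0 mut_corr0 addr0.
    by case: eqP => // ->; rewrite a0 oppr0.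
  have -> : y = w (cl l).
    rewrite exchange eqxx /y QQ (ev_exch_ext (w' := v) inv a0) // => j jk.
    by rewrite /v' (negbTE jk).
  by split; [apply: Tw | apply: regular_unit].
have [m [fm mk Vz0E]] := Vz_0 a0.
have [m1 [A [fA V1E]]] := T0Vz 1.
have [t Tt e] : exists2 t, T t & Vz.[v (cl l)] =
    Vz.[0] + v (cl l) * (Vz`_1 + v (cl l) * t).
  by rewrite horner_coef0; apply: horner_split2 => // i; apply/T0T/T0Vz.
(* D clears the powers of the variable k in the denominators of both the
   constant and the linear coefficient of Vz *)
pose D := w (cl k) ^+ (m1 + `|a|)%N.
pose M1 : {mpoly int[N + M]} := 'X_[m + U_(cl k) *+ m1].
have M1E : M1 = 'X_[m] * 'X_(cl k) ^+ m1 by rewrite /M1 mpolyXD mpolyXn.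
pose L := M1 * 'X_(cl l) + 'X_(cl k) ^+ `|a|%N * A.
have wL : ev w L = ev w 'X_[m] * w (cl k) ^+ m1 * w (cl l) +
    w (cl k) ^+ `|a|%N * ev w A.
  by rewrite /L M1E rmorphD !(rmorphM (ev w)) !(rmorphXn (ev w)) /= !evX.
have shuffle (f g h r V0 V1 u z : F) : r != 0 -> u != 0 -> z = r / u ->
    g * V0 = h * r ->
    f * g * ((V0 + z * (V1 + z * t)) / z) =
    h * f * u + g * (V1 * f) + r * (u^-1 * (f * g * t)).
  move=> r0 u0 -> e1.
  transitivity (f * (g * V0) * u / r + g * (V1 * f) + r * (u^-1 * (f * g * t))).
    by field; rewrite r0 u0.
  by rewrite e1; field; rewrite r0 u0.
have DE : D * y = ev w L + q * ((w (cl l))^-1 * (D * t)).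
  rewrite yE e wL -V1E /D exprD.
  exact: shuffle.
have TD : T D by apply: subringX.
split.
  rewrite -[y](mulKf (expf_neq0 (m1 + `|a|) (w0 (cl k)))) -/D DE.
  apply: (subringM sT); first by rewrite /D -exprVn; apply: subringX.
  apply: (subringD sT) => //; apply: (subringM sT) => //.
  by apply: (subringM sT) => //; apply: (subringM sT).
apply: (regular_cancel sT TD); rewrite DE.
apply: (regular_congr sT q0 _ (erefl _)); first by do 2 apply: subringM => //.
apply: (regular_ev sT IT locT injw (exch_neq0 l inv)) => h.
apply: dvd_mul_affine.
- exact: free_exch.
- by rewrite /free_of M1E rmorphM /= fm (freeX _ kl').
- by rewrite /free_of rmorphM /= fA (freeX _ kl').
- by move=> g; apply: dvd_mul_monom => j; apply: kill_exch_neq0.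
Qed.
End RankTwo.

(** * Laurent rings of adjacent seeds *)

Lemma regular_prod (F : fieldType) (T : F -> Prop) q n (x : 'I_n -> F) :
    subring_pred T -> (forall i, T (x i) /\ regular T q (x i)) ->
  T (\prod_i x i) /\ regular T q (\prod_i x i).
Proof.
move=> sT xP; elim/big_rec: _ => [|i p _ [Tp rp]].
  by split; [apply: subring1 | move=> h _; rewrite mul1r].
by have [Tx rx] := xP i; split; [apply: subringM | apply: regularM].
Qed.

(** The form in which [regular_denominators] meets clusters: one cluster variable
   [x i0] is [q] up to a unit and the others are units, while all variables of
   the second cluster are regular modulo [q]. *)
Lemma laurent_denominators (F : fieldType) (T : F -> Prop) q u y n
    (x x' : 'I_n -> F) i0 m m' :
    subring_pred T -> q != 0 -> T q -> u != 0 -> T u^-1 -> x i0 = q * u ->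
    (forall i, i != i0 -> x i != 0 /\ T (x i)^-1) ->
    (forall i, T (x' i) /\ regular T q (x' i)) ->
    T (y * (\prod_i x i) ^+ m) -> T (y * (\prod_i x' i) ^+ m') ->
  T y.
Proof.
move=> sT q0 Tq u0 Tu xi0 xP x'P yx yx'; have [Tx' rx'] := regular_prod sT x'P.
apply: (regular_denominators sT (a := m) q0 Tq Tx' rx') yx'.
have c0 : \prod_(i | i != i0) x i != 0.
  by apply/prodf_neq0 => i ii0; have [] := xP i ii0.
have Tc : T (\prod_(i | i != i0) x i)^-1.
  rewrite -prodfV; apply: (subring_prod sT) => i ii0; have [] := xP i ii0.
  by [].
move: yx; rewrite (bigD1 i0) //= xi0; move: (\prod_(i | _) _) c0 Tc => c c0 Tc.
have -> : y * q ^+ m = y * (q * u * c) ^+ m * (u^-1 * c^-1) ^+ m.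
  by rewrite -mulrA -exprMn; congr (_ * _ ^+ _); field; rewrite u0 c0.
by move=> Ty; apply: (subringM sT) => //; apply: subringX => //; apply: subringM.
Qed.

Section LaurentRings.
Variables (N M : nat) (d : 'I_N -> nat) (Ahat : ratfun N M -> Prop).
Hypothesis hAhat : is_subring Ahat.
Hypothesis hA_Ahat : forall y, @ringA N M y -> Ahat y.
Hypothesis hAhat_loc : is_localization (@ringA N M) Ahat.
Implicit Types (S : seed M d) (k l : 'I_N).
Local Notation cl i := (lshift M i).

Definition laurent_at S : ratfun N M -> Prop := laurent_ring Ahat (cluster S).

Lemma ringA_image S y : ringA y -> image_ev (ext_cluster S) y.
Proof.
have sI := image_ev_subring (ext_cluster S).
case=> p [Kp ->]; apply: (subring_meval sI) => [m|j].
  by have [z ->] := Kp m; apply: (subring_int sI).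
by exists 'X_(rshift N j); rewrite evX ext_cluster_stable.
Qed.

Lemma stable_Ahat j : Ahat (stable N j).
Proof. by apply: hA_Ahat; apply: poly_ring_var; apply: is_int_subring. Qed.

Section OneSeed.
Variable S : seed M d.
Hypothesis inv : seed_inv S.

Let x0 i : cluster S i != 0. Proof. exact: cluster_neq0. Qed.

Lemma laurent_at_subring : subring_pred (laurent_at S).
Proof. exact: laurent_subring. Qed.

Lemma laurent_at_image y : image_ev (ext_cluster S) y -> laurent_at S y.
Proof.
case=> p ->; apply: (subring_ev laurent_at_subring) => j.
case: (split_ordP j) => i ->; first by rewrite ext_cluster_cl; apply: laurent_var.
by rewrite ext_cluster_stable; apply: laurent_const => //; apply: stable_Ahat.
Qed.

Lemma laurent_at_localization :
  is_localization (image_ev (ext_cluster S)) (laurent_at S).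
Proof.
have sA : is_subring (@ringA N M) by apply/poly_ring_subring/is_int_subring.
apply: (laurent_localization sA hAhat _ hAhat_loc) => //.
- exact: image_ev_subring.
- exact: ringA_image.
- by move=> i; exists 'X_(cl i); rewrite evX ext_cluster_cl.
Qed.
End OneSeed.

(** The condition at [S] bounds the denominator of [y] in the Laurent ring of
   [mutate S l] by a power of the exchange polynomial, the one at the other seed
   bounds it by a product of elements that are regular modulo that polynomial. *)
Lemma laurent_step S k l y : seed_inv S -> coprime_seed S -> k != l ->
    laurent_at S y -> laurent_at (mutate (mutate S k) l) y ->
  laurent_at (mutate S l) y.
Proof.
move=> inv cop kl yS yS''.
have inv_l := seed_inv_mutate l inv; have inv' := seed_inv_mutate k inv.
have inv'' := seed_inv_mutate l inv'.
pose T := laurent_at (mutate S l); rewrite -/(T y).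
have sT : subring_pred T := laurent_at_subring inv_l.
have IT : forall c, image_ev (ext_cluster (mutate S l)) c -> T c.
  exact: laurent_at_image.
have locT := laurent_at_localization inv_l.
have injw : injective (ev (ext_cluster (mutate S l))) by case: inv_l.
pose v := ext_cluster S; pose w := ext_cluster (mutate S l).
have v0 j : v j != 0 by apply: ext_cluster_neq0.
have exchange j : w j =
    if j == cl l then ev v (exch_poly S l) / v (cl l) else v j.
  by rewrite /w ext_cluster_mutate -ext_cluster_cl.
have TwV i : T (w (cl i))^-1.
  by rewrite /w ext_cluster_cl; apply: laurent_varV => //; apply: cluster_neq0.
have copQP : coprime_elts (exch_poly S l) (exch_poly S k).
  by apply: cop; rewrite eq_sym.
have [Tx Rx] := @regular_exchange1 _ _ _ S k l _ v w inv kl copQP v0 exchange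
  injw T sT IT locT TwV.
have [Ty Ry] := @regular_exchange2 _ _ _ S k l _ v w inv kl exchange injw T
  sT IT locT TwV.
have xE : cluster (mutate S k) k = ev v (exch_poly S k) / v (cl k).
  by rewrite -ext_cluster_cl ext_cluster_mutate eqxx /v ext_cluster_cl.
have yE : cluster (mutate (mutate S k) l) l = ev
    (fun j => if j == cl k then ev v (exch_poly S k) / v (cl k) else v j)
    (exch_poly (mutate S k) l) / v (cl l).
  rewrite -[LHS]ext_cluster_cl ext_cluster_mutate eqxx.
  rewrite -[cluster _ l]ext_cluster_cl (ext_cluster_mutate S k).
  rewrite eq_lshift eq_sym (negbTE kl); congr (_ / _); apply: eq_ev => j.
  by rewrite ext_cluster_mutate /v ext_cluster_cl.
have KT c : Ahat c -> T c by apply: laurent_const.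
have Tw j : T (w j) by apply: IT; exists 'X_j; rewrite evX.
have wE i : i != l -> w (cl i) = cluster S i.
  by move=> il; rewrite exchange eq_lshift (negbTE il) /v ext_cluster_cl.
have qE : ev w (exch_poly S l) = ev v (exch_poly S l).
  apply: (ev_exch_ext inv (exmat_diag l inv)) => j jl.
  by rewrite exchange (negbTE jl).
have w0 j : w j != 0 by apply: ext_cluster_neq0.
have Tq : T (ev w (exch_poly S l)) by apply: IT; exists (exch_poly S l).
have q0 : ev w (exch_poly S l) != 0.
  by rewrite -(rmorph0 (ev w)) (inj_eq injw) exch_neq0.
have zE : cluster S l = ev w (exch_poly S l) * (w (cl l))^-1.
  have -> : cluster S l = v (cl l) by rewrite /v ext_cluster_cl.
  rewrite exchange eqxx -qE invfM invrK mulrA mulfV // mul1r.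
  by [].
have clT i : T (cluster S i).
  have [->|il] := eqVneq i l; last by rewrite -(wE i il).
  by rewrite zE; apply: (subringM sT Tq (TwV l)).
have cl''P i : let c := cluster (mutate (mutate S k) l) i in
    T c /\ regular T (ev w (exch_poly S l)) c.
  have [->|il] /= := eqVneq i l.
    by split; [move: Ty | move: Ry]; rewrite -yE.
  rewrite /mut_cluster (negbTE il).
  have [->|ik] := eqVneq i k; first by rewrite xE.
  rewrite /= /mut_cluster (negbTE ik) -(wE i il).
  by split; [exact (Tw (cl i)) | exact (regular_unit sT (w0 (cl i)) (TwV i))].
have [m yS1] := laurent_clear (fun i => cluster_neq0 i inv) sT KT clT yS.
have [m'' yS2] := laurent_clear (fun i => cluster_neq0 i inv'') sT KT
  (fun i => proj1 (cl''P i)) yS''.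
apply: (laurent_denominators sT q0 Tq _ _ zE _ cl''P yS1 yS2).
- exact (invr_neq0 (w0 (cl l))).
- by rewrite invrK; apply: Tw.
- by move=> i il; rewrite -(wE i il); split; [apply: w0 | apply: TwV].
Qed.
End LaurentRings.

(** * Nerves *)

Section Nerves.
Variable N : nat.
Implicit Types (u v w r : tvertex N) (V : {fset tvertex N}) (k l : 'I_N).

Lemma shortest_vertex V v : v \in V ->
  exists2 r, r \in V & forall u, u \in V -> (size r <= size u)%N.
Proof.
move=> vV; have ex : exists n, has (fun u => size (tword u) == n) V.
  by exists (size v); apply/hasP; exists v.
case: (ex_minnP ex) => n /hasP[r rV /eqP rn] min; exists r => // u uV.
by rewrite rn; apply: min; apply/hasP; exists u.
Qed.

(** A path from [v] to the shortest vertex leaves the branch above [v] through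
   the edge from [v] to its parent. *)
Lemma parent_in V v r :
    (forall u w, u \in V -> w \in V -> exists p : seq (tvertex N),
       [/\ path (@tadj N) u p, all (mem V) p & last u p = w]) ->
    r \in V -> (forall u, u \in V -> (size r <= size u)%N) ->
    v \in V -> v != r ->
  exists k w, w \in V /\ tword v = k :: tword w.
Proof.
move=> conn rV rmin vV vr; have [p [pp pV pr]] := conn v r vV rV.
suff main u s : tword u = s ++ tword v -> path (@tadj N) u p -> last u p = r ->
    exists k w, w \in V /\ tword v = k :: tword w.
  exact: (main v [::]).
elim: p pV u s {pp pr} => [_|u' p IHp /= /andP[u'V pV]] u s uE /=.
  move=> _ ur; case/eqP: vr; apply: val_inj => /=.
  have := rmin v vV; rewrite -ur uE size_cat -{2}[size v]add0n leq_add2r leqn0.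
  by rewrite size_eq0 => /eqP->.
case/andP => /existsP[k /orP[/eqP uk|/eqP uk]] pp pr; last first.
  by apply: (IHp pV u' (k :: s)) => //; rewrite uk uE.
case: s uE => [|k' s] /= uE; first by exists k, u'; rewrite -uE uk.
by apply: (IHp pV u' s) => //; move: uE; rewrite uk => -[].
Qed.

(** The vertices other than the shortest one are as many as the labels, and the
   edges to their parents have distinct labels. *)
Lemma nerve_label V l : is_nerve V ->
  exists u v, [/\ u \in V, v \in V & tedge l u v].
Proof.
move=> [cardV conn distinct]; apply: NNPP => nol.
have [v0 v0V] : exists v, v \in V.
  have : (0 < #|` V|)%N by rewrite cardV.
  by rewrite cardfs_gt0 => /fset0Pn.
have [r rV rmin] := shortest_vertex v0V.
have parent := parent_in conn rV rmin.
pose s := [seq ohead (tword v) | v <- rem r V].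
have inr v : v \in rem r V -> v \in V /\ v != r.
  by rewrite mem_rem_uniq ?fset_uniq // inE => /andP[].
have us : uniq s.
  rewrite map_inj_in_uniq ?rem_uniq ?fset_uniq //.
  move=> v v' /inr[vV vr] /inr[v'V v'r].
  have [k [w [wV vE]]] := parent v vV vr.
  have [k' [w' [w'V v'E]]] := parent v' v'V v'r.
  rewrite vE v'E => -[kk']; rewrite -kk' in v'E.
  have e : tedge k v w by rewrite /tedge vE eqxx.
  have e' : tedge k v' w' by rewrite /tedge v'E eqxx.
  have [[-> //]|[v'w w'v]] := distinct k v w v' w' vV wV v'V w'V e e'.
  have sv : size v = (size v').+1 by rewrite vE v'w.
  have sv' : size v' = (size v).+1 by rewrite v'E w'v.
  by move/eqP: sv; rewrite sv' -[X in X == _]addn0 -addn2 eqn_add2l.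
have sub : {subset s <= [seq Some k | k in predC1 l]}.
  move=> _ /mapP[v /inr[vV vr] ->]; have [k [w [wV vE]]] := parent v vV vr.
  rewrite vE /=; apply/imageP; exists k => //.
  rewrite inE; apply/eqP => kl; apply: nol; exists v, w; split=> //.
  by rewrite /tedge vE kl eqxx.
have := uniq_leq_size us sub.
rewrite size_map size_rem // -/(#|` V|) cardV size_map -cardE /=.
have := cardC1 l; rewrite card_ord => ->.
by have := leq_ltn_trans (leq0n l) (ltn_ord l); move: N => n; lia.
Qed.
End Nerves.

Section UpperBounds.
Variables (N M : nat) (d : 'I_N -> nat) (Ahat : ratfun N M -> Prop).
Variable S0 : seed M d.
Hypothesis inv0 : seed_inv S0.
Hypothesis hAhat : is_subring Ahat.
Hypothesis hA_Ahat : forall y, @ringA N M y -> Ahat y.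
Hypothesis hAhat_loc : is_localization (@ringA N M) Ahat.
Hypothesis hcoprime : forall S, in_GC S0 S -> coprime_seed S.
Local Notation seq_at := (mutate_seq S0).
Local Notation laurent := (laurent_at Ahat).

Lemma seed_inv_seq s : seed_inv (seq_at s).
Proof. by elim: s => [|k s IHs] //=; apply: seed_inv_mutate. Qed.

Lemma laurent_step_seq s k l y : k != l -> laurent (seq_at s) y ->
  laurent (mutate (mutate (seq_at s) k) l) y -> laurent (mutate (seq_at s) l) y.
Proof.
apply: laurent_step => //; first exact: seed_inv_seq.
by apply: hcoprime; exists s.
Qed.

Definition laurent_star y (S : seed M d) : Prop :=
  laurent S y /\ forall l, laurent (mutate S l) y.

(** In a direction [l] other than [k], apply the step at the new seed: mutating it
   back in direction [k] and then in direction [l] gives the neighbour of the old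
   seed in direction [l]. *)
Lemma laurent_star_cons y k s :
  laurent_star y (seq_at s) -> laurent_star y (seq_at (k :: s)).
Proof.
case=> ys ysl; split=> [|l]; first exact: ysl.
have [<-|kl] := eqVneq k l; first by rewrite /= mutateK //; apply: seed_inv_seq.
apply: (@laurent_step_seq (k :: s) k l y kl); first exact: ysl.
by rewrite /= mutateK; [apply: ysl | apply: seed_inv_seq].
Qed.

Lemma laurent_star_behead y k s :
  laurent_star y (seq_at (k :: s)) -> laurent_star y (seq_at s).
Proof.
move/(@laurent_star_cons y k); rewrite /= mutateK //; exact: seed_inv_seq.
Qed.

Lemma laurent_star_all y s t :
  laurent_star y (seq_at s) -> laurent_star y (seq_at t).
Proof.
move=> ys; have y0 : laurent_star y (seq_at [::]).
  by elim: s ys => // k s IHs /laurent_star_behead.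
by elim: t => // k t; apply: laurent_star_cons.
Qed.

Lemma seed_at_edge k u v : tedge k u v -> seed_at S0 v = mutate (seed_at S0 u) k.
Proof.
rewrite /seed_at => /orP[]/eqP->//=; rewrite mutateK //; exact: seed_inv_seq.
Qed.

(** Being Laurent at the neighbour in direction [l] holds at the ends of the edge
   labelled [l], where that neighbour is in the nerve, and spreads along the other
   edges by [laurent_step_seq]. *)
Lemma upper_bound_star V y v : is_nerve V -> v \in V ->
  upper_bound Ahat S0 V y -> laurent_star y (seed_at S0 v).
Proof.
move=> nV vV yV; split=> [|l]; first exact: yV.
have [u [u' [uV u'V ul]]] := nerve_label l nV.
have [_ conn _] := nV; have [p [pp pV <-]] := conn u v uV vV.
have : laurent (mutate (seed_at S0 u) l) y.
  by rewrite -(seed_at_edge ul); apply: yV.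
elim: p u pp pV uV {ul} => //= w p IHp u.
move=> /andP[/existsP[k uk] pp] /andP[wV pV] uV yul.
apply: (IHp w) => //; have [kl|kl] := eqVneq k l.
  by rewrite -kl (seed_at_edge uk) mutateK; [apply: yV | apply: seed_inv_seq].
apply: (laurent_step_seq kl); first exact: yV.
have -> : mutate (seq_at w) k = seed_at S0 u.
  by apply/esym/seed_at_edge; rewrite /tedge orbC.
exact: yul.
Qed.

Lemma upper_bound_algebra V y : is_nerve V ->
  upper_bound Ahat S0 V y <-> upper_algebra Ahat S0 y.
Proof.
move=> nV; split=> [yV _ [s ->]|yA v _]; last by apply: yA; exists v.
have [v vV] : exists v, v \in V.
  have [cardV _ _] := nV; have : (0 < #|` V|)%N by rewrite cardV.
  by rewrite cardfs_gt0 => /fset0Pn.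
by have [] := laurent_star_all s (upper_bound_star nV vV yV).
Qed.
End UpperBounds.

Lemma map_intr_ev n (f : {mpoly int[n]}) :
  map_mpoly intr f = ev (fun j => 'X_j : {mpoly rat[n]}) f.
Proof.
elim/mpoly_gen_ind: f => [c|i|f g ef eg|f g ef eg].
- by rewrite evC map_mpolyC rmorph_int.
- by rewrite evX map_mpolyX.
- by rewrite !rmorphD /= ef eg.
- by rewrite !rmorphM /= ef eg.
Qed.

(** A transcendence basis of cluster variables makes the cluster and the stable
   variables algebraically independent: a relation between them with integer
   coefficients is one between the cluster variables with coefficients in the
   ground ring, so all these coefficients vanish, and the relation also holds
   between the variables of the field of rational functions. *)
Lemma seed_inv_initial N M (d : 'I_N -> nat) (S : seed M d) :
  is_seed S -> seed_inv S.
Proof.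
case=> [[indep _] skew dv st]; split=> //; first 1 last.
- exact: skew_principal.
- move=> i; have [di dvi] := dv i; split=> // j.
  by apply: dvdn_trans dvi _; apply: (biggcdn_inf j).
apply: raddf_inj => f f0.
pose g j : {mpoly (ratfun N M)[N]} :=
  match split j with inl i => 'X_i | inr j => (stable N j)%:MP end.
have sA : is_subring (@ringA N M) by apply/poly_ring_subring/is_int_subring.
have gA m : ringA (ev g f)@_m.
  move: m; apply: (subring_ev (subring_mpoly _ sA)) => j m.
  rewrite /g; case: (split j) => i; first exact: mcoeff_varP.
  by apply: mcoeff_constP => //; apply/poly_ring_var/is_int_subring.
have g_eval (x : 'I_N -> ratfun N M) : (ev g f).@[x] =
    ev (fun j => match split j with inl i => x i | inr j => stable N j end) f.
  rewrite (morph_ev (meval x)); apply: eq_ev => j /=; rewrite /g.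
  by case: (split j) => i; rewrite ?mevalXU ?mevalC.
have g0 : ev g f = 0.
  apply: indep; last by rewrite g_eval.
  move=> m; exists (ev g f)@_m, 1; rewrite divr1 oner_neq0; split=> //.
    have [p [Kp ->]] := gA m; exists p, 0%MM; split=> //.
    by rewrite big1 ?divr1 // => i _; rewrite mnm0E.
  exists 1, 0%MM; split; last first.
    by rewrite meval1 big1 ?divr1 // => i _; rewrite mnm0E.
  by apply: (subring1 (subring_mpoly _ (is_int_subring _))).
have := g_eval (fun i => tofrac 'X_(lshift M i)); rewrite g0 meval0.
rewrite (@eq_ev _ _ _ (@tofrac {mpoly rat[N + M]} \o (fun j => 'X_j))) => [|j].
  rewrite -morph_ev -map_intr_ev => /esym/eqP; rewrite tofrac_eq0 => /eqP f1.
  apply/mpolyP => m; have := congr1 (mcoeff m) f1.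
  by rewrite mcoeff_map_mpoly !mcoeff0 => /eqP; rewrite intr_eq0 => /eqP.
by case: (split_ordP j) => i ->.
Qed.

Theorem theorem4p1 (N M : nat) (d : 'I_N -> nat) (S0 : seed M d)
    (Ahat : ratfun N M -> Prop)
    (hS0 : is_seed S0)
    (hAhat : is_subring Ahat)
    (hA_Ahat : forall y, @ringA N M y -> Ahat y)
    (hAhat_Abar : forall y, Ahat y -> @ringAbar N M y)
    (hAhat_loc : is_localization (@ringA N M) Ahat)
    (hcoprime : forall S, in_GC S0 S -> coprime_seed S) :
  (forall V V' : {fset tvertex N}, is_nerve V -> is_nerve V' ->
     forall y, upper_bound Ahat S0 V y <-> upper_bound Ahat S0 V' y) /\
  (forall V : {fset tvertex N}, is_nerve V ->
     forall y, upper_bound Ahat S0 V y <-> upper_algebra Ahat S0 y).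
Proof.
have inv0 := seed_inv_initial hS0.
have main V : is_nerve V ->
    forall y, upper_bound Ahat S0 V y <-> upper_algebra Ahat S0 y.
  by move=> nV y; apply: upper_bound_algebra.
split=> // V V' nV nV' y; have := main V nV y; have := main V' nV' y; tauto.
Qed.
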